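(* Let $\mathcal{H}$ be an infinite-dimensional, complex, separable Hilbert space, and let $T \in \mathcal{B}(\mathcal{H})$. If $T$ has property (CR), then there exist $\lambda, \mu \in \mathbb{C}$ and $A \in \mathcal{B}(\mathcal{H})$, with $A$ either selfadjoint or an orthogonally reductive unitary operator, such that $T = \lambda A + \mu I$. In particular, if $T$ has property (CR), then $T$ is normal with circlinear spectrum.
   Context: $\mathcal{B}(\mathcal{H})$ is the algebra of bounded linear operators on $\mathcal{H}$. A projection means an orthogonal projection, and $P^\perp = I - P$. $T$ has the common rank property (CR) if $\mathrm{rank}\, P T P^\perp = \mathrm{rank}\, P^\perp T P$ for every projection $P \in \mathcal{B}(\mathcal{H})$ (ranks may be infinite). An operator $X$ is orthogonally reductive if for every projection $P$, $P X P^\perp = 0$ implies $P^\perp X P = 0$. A subset of $\mathbb{C}$ is circlinear if it is contained in a circle or in a straight line. *)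

(* Defs.v *)
From HB Require Import structures.
From mathcomp Require Import all_boot all_order all_algebra.
From mathcomp Require Import complex.
From mathcomp Require Import all_classical all_reals.
From mathcomp Require Import ereal topology normedtype.

Set Implicit Arguments.
Unset Strict Implicit.
Unset Printing Implicit Defensive.

Import Order.TTheory GRing.Theory Num.Theory Num.Def.
Import numFieldNormedType.Exports.

Local Open Scope classical_set_scope.
Local Open Scope complex_scope.
Local Open Scope ring_scope.

(* The inner product is linear in its first argument and conjugate-linear in
   its second one (convention of [{dot _ for _}]). *)
HB.mixin Record NormedModule_isHilbert (R : realType) H
    & CompleteNormedModule R[i] H := {
  inner : {dot H for @conjC R[i]} ;
  inner_norm : forall x : H, inner x x = `|x| ^+ 2
}.

#[short(type="hilbertType")]
HB.structure Definition Hilbert (R : realType) :=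
  {H of NormedModule_isHilbert R H & CompleteNormedModule R[i] H}.

Definition separable (T : topologicalType) :=
  exists2 D : set T, countable D & dense D.

Section Dimension.
Variables (R : realType) (V : lmodType R[i]).

Definition lin_indep n (v : 'I_n -> V) :=
  forall c : 'I_n -> R[i], \sum_(i < n) c i *: v i = 0 -> forall i, c i = 0.

(* All infinite dimensions are identified with +oo. *)
Definition lin_dim (S : set V) : \bar R :=
  ereal_sup [set (n%:R)%:E | n in
    [set n | exists2 v : 'I_n -> V, lin_indep v & forall i, S (v i)]].

Definition infinite_dimensional := lin_dim [set: V] = +oo%E.

End Dimension.

Arguments infinite_dimensional {R} V.

Section Operators.
Variables (R : realType) (H : hilbertType R).

Record bounded_operator := BoundedOperator {
  operator_linear :> {linear H -> H} ;
  operator_bounded :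
    exists M : R, forall x, `|operator_linear x| <= M%:C * `|x|
}.

Implicit Types (A P S T : bounded_operator) (X : H -> H).

Definition rank X : \bar R := lin_dim (range X).

(* [is_adjoint T S] determines S uniquely: S = T^*. *)
Definition is_adjoint T S := forall x y : H, inner (T x) y = inner x (S y).

Definition selfadjoint T := is_adjoint T T.

Definition normal_operator T := exists2 S, is_adjoint T S & T \o S =1 S \o T.

Definition unitary_operator T :=
  exists2 S, is_adjoint T S & S \o T =1 idfun /\ T \o S =1 idfun.

Definition projection P := P \o P =1 P /\ selfadjoint P.

(* I - P *)
Definition perp P : H -> H := idfun \- P.

Definition common_rank T := forall P, projection P ->
  rank (P \o T \o perp P) = rank (perp P \o T \o P).

Definition orthogonally_reductive T := forall P, projection P ->
  P \o T \o perp P =1 \0 -> perp P \o T \o P =1 \0.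

Definition spectrum T : set R[i] := [set z |
  ~ exists S, S \o (T \- z \*: idfun) =1 idfun /\
              (T \- z \*: idfun) \o S =1 idfun].

End Operators.

Arguments bounded_operator {R} H.

Notation "''B' ( H )" := (bounded_operator H) (format "''B' ( H )") : type_scope.

Section Circlinear.
Variable R : realType.

Definition circle (c : R[i]) (r : R) : set R[i] := [set z | `|z - c| = r%:C].

Definition line (a d : R[i]) : set R[i] := [set a + t%:C * d | t in [set: R]].

Definition circlinear (S : set R[i]) :=
  (exists c r, 0 < r /\ S `<=` circle c r) \/
  (exists a d, d != 0 /\ S `<=` line a d).

End Circlinear.

(* Main.v *)
Require Import Defs.
From HB Require Import structures.
From mathcomp Require Import all_boot all_order all_algebra.
From mathcomp Require Import complex.
From mathcomp Require Import all_classical all_reals.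
From mathcomp Require Import ereal topology normedtype.
From mathcomp Require Import ring lra.

(* Only projections of rank 1 and 2 are needed. Let S = T^*. Comparing ranks for the
   projection onto span (x, T x) shows that x, T x, S x, S T x are linearly dependent
   for every vector x, and rank one projections show that T and S have the same
   eigenvectors. Local dependence is upgraded to a global relation
     a I + b T + c S + d S T = 0,  (a, b, c, d) <> 0,
   as follows. Operators that are independent modulo finite rank can be added to a
   family of finite-rank operators independent at some vector, keeping independence
   at some other vector; hence the finite-rank operators occurring in span (I, T, S,
   S T) are themselves locally dependent. Up to linear dependence there is one of
   them, or there are two, which may be taken selfadjoint, or T - a is of finite rank
   and there are three; in the last case T is diagonalizable and the relation is
   obtained by testing on a sum of eigenvectors. If d = 0, the relation makes T affine
   in a selfadjoint operator; otherwise, T is affine in an isometry, which is unitary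
   because T and S have the same eigenvectors. *)

Set Implicit Arguments.
Unset Strict Implicit.
Unset Printing Implicit Defensive.

Import Order.TTheory GRing.Theory Num.Theory.
Import numFieldNormedType.Exports.
Local Open Scope classical_set_scope.
Local Open Scope complex_scope.
Local Open Scope ring_scope.

(** * Linear combinations and finite rank *)

Section LinearCombinations.
Variables (F : fieldType) (V : lmodType F).
Implicit Types (s t : seq V) (c d : nat -> F).

(** Coefficients are sequences on [nat], of which only the values below [size s] count; consing and
    concatenating families then needs no change of index type. *)
Definition comb c s := \sum_(i < size s) c i *: s`_i.

Definition indep s :=
  forall c, comb c s = 0 -> forall i, (i < size s)%N -> c i = 0.

Definition spanned s x := exists c, x = comb c s.

(** The spanning list may be dependent, so such lists can simply be concatenated for sums and mapped
    for adjoints. *)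
Definition finite_rank (U : Type) (X : U -> V) :=
  exists s, forall x, spanned s (X x).

Lemma comb_nil c : comb c [::] = 0.
Proof. by rewrite /comb big_ord0. Qed.

Lemma comb_cons c a s : comb c (a :: s) = c 0%N *: a + comb (c \o succn) s.
Proof. by rewrite /comb /= big_ord_recl. Qed.

Lemma eq_comb c d s : (forall i, (i < size s)%N -> c i = d i) ->
  comb c s = comb d s.
Proof. by move=> cd; apply: eq_bigr => i _; rewrite cd. Qed.

Lemma combD c d s : comb (c \+ d) s = comb c s + comb d s.
Proof. by rewrite -big_split /=; apply: eq_bigr => i _; rewrite scalerDl. Qed.

Lemma combZ a c s : comb (a \*o c) s = a *: comb c s.
Proof. by rewrite scaler_sumr; apply: eq_bigr => i _; rewrite scalerA. Qed.

Lemma comb0 s : comb (fun=> 0) s = 0.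
Proof. by rewrite /comb big1 // => i _; rewrite scale0r. Qed.

Lemma comb_cat c d s t :
  comb (fun i => if (i < size s)%N then c i else d (i - size s)%N) (s ++ t) =
  comb c s + comb d t.
Proof.
rewrite /comb size_cat big_split_ord /=; congr (_ + _); apply: eq_bigr => i _.
  by rewrite nth_cat ltn_ord.
by rewrite nth_cat ltnNge leq_addr /= addKn.
Qed.

Lemma spannedD s x y : spanned s x -> spanned s y -> spanned s (x + y).
Proof. by move=> [c ->] [d ->]; exists (c \+ d); rewrite combD. Qed.

Lemma spannedZ s a x : spanned s x -> spanned s (a *: x).
Proof. by move=> [c ->]; exists (a \*o c); rewrite combZ. Qed.

Lemma spanned0 s : spanned s 0.
Proof. by exists (fun=> 0); rewrite comb0. Qed.

Lemma spanned_catl s t x : spanned s x -> spanned (s ++ t) x.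
Proof. by move=> [c ->]; eexists; rewrite -[LHS]addr0 -(comb0 t) -comb_cat. Qed.

Lemma spanned_catr s t x : spanned t x -> spanned (s ++ t) x.
Proof. by move=> [c ->]; eexists; rewrite -[LHS]add0r -(comb0 s) -comb_cat. Qed.

Lemma spanned_nth s i : (i < size s)%N -> spanned s s`_i.
Proof.
move=> lt_is; exists (fun j => (j == i)%:R).
rewrite /comb (bigD1 (Ordinal lt_is)) //= eqxx scale1r big1 ?addr0 // => j nji.
by rewrite -(inj_eq val_inj) /= in nji; rewrite (negbTE nji) scale0r.
Qed.

Lemma indep_cons a s : ~ spanned s a -> indep s -> indep (a :: s).
Proof.
move=> nsa inds c; rewrite comb_cons => c0.
have c00 : c 0%N = 0.
  apply/eqP/negP => /negP nz; apply: nsa; exists (- (c 0%N)^-1 \*o (c \o succn)).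
  rewrite combZ -[a]scale1r -(mulVf nz) -scalerA.
  by move/eqP: c0; rewrite addr_eq0 => /eqP ->; rewrite scaleNr scalerN.
move: c0; rewrite c00 scale0r add0r => c0 [//|i] /= lt_is.
exact: (inds _ c0).
Qed.

Lemma indep_shear a d s : indep (a :: s) -> indep (a + comb d s :: s).
Proof.
move=> inds c; rewrite comb_cons => c0.
have /inds c'0 : comb (fun j => if j is k.+1 then c 0%N * d k + c k.+1 else c 0%N)
    (a :: s) = 0.
  rewrite comb_cons -[RHS]c0 scalerDr -addrA; congr (_ + _).
  by rewrite -combZ -combD.
have c00 := c'0 0%N (ltn0Sn _).
by move=> [//|i] lt_is; have := c'0 i.+1 lt_is; rewrite c00 mul0r add0r.
Qed.

Lemma indep_scale a k s : k != 0 -> indep (a :: s) -> indep (k *: a :: s).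
Proof.
move=> k0 inds c; rewrite comb_cons scalerA => c0.
have /inds c'0 : comb (fun j => if j is i.+1 then c i.+1 else c 0%N * k)
    (a :: s) = 0 by rewrite comb_cons.
move=> [|i] lt_is; last exact: (c'0 i.+1).
by have /eqP := c'0 0%N lt_is; rewrite mulf_eq0 (negbTE k0) orbF => /eqP.
Qed.

(** With more rows than columns, the coordinate matrix of [t] over [s] is killed on the left by a
    nonzero row, whose entries give a forbidden relation on [t]. *)
Lemma steinitz s t : indep t -> (forall i, (i < size t)%N -> spanned s t`_i) ->
  (size t <= size s)%N.
Proof.
move=> indt st; rewrite leqNgt; apply/negP => lt_st.
have /choice[C CE] (i : 'I_(size t)) := st i (ltn_ord i).
pose M := \matrix_(i < size t, j < size s) C i j.
have : kermx M != 0.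
  rewrite kermx_eq0 /row_free neq_ltn.
  by rewrite (leq_ltn_trans (rank_leq_col M) lt_st).
case/rowV0Pn => u /sub_kermxP uM; case/negP; apply/eqP/rowP => i.
(* The row [u] is extended by 0 to all of [nat], as [comb] requires. *)
pose c k := if insub k is Some j then u 0 j else 0.
have cE (j : 'I_(size t)) : c j = u 0 j by rewrite /c valK.
rewrite mxE -cE; apply: indt => //.
rewrite /comb; under eq_bigr => j _ do rewrite cE CE scaler_sumr.
rewrite exchange_big big1 //= => j _.
under eq_bigr => k _ do rewrite scalerA.
rewrite -scaler_suml; move/rowP/(_ j): uM; rewrite !mxE.
by under eq_bigr => k _ do rewrite mxE; move=> ->; rewrite scale0r.
Qed.

Lemma comb_comb s t (c : nat -> F) (M : 'M[F]_(size t, size s)) (d : nat -> F) :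
  (forall i : 'I_(size t), t`_i = \sum_j M i j *: s`_j) ->
  (forall j : 'I_(size s), \sum_(i < size t) c i * M i j = d j) ->
  comb c t = comb d s.
Proof.
move=> tM cd; rewrite /comb; under eq_bigr => i _ do rewrite tM scaler_sumr.
rewrite exchange_big; apply: eq_bigr => j _; rewrite -cd scaler_suml.
by apply: eq_bigr => i _; rewrite scalerA.
Qed.

(** The coordinate matrix M of [t] over [s] is invertible because [t] is independent. A relation on
    [s] with coefficient row r is then the relation r M^-1 on [t], which is trivial. *)
Lemma indep_exchange s t : indep t -> size s = size t ->
  (forall i, (i < size t)%N -> spanned s t`_i) -> indep s.
Proof.
move=> indt st tsp c c0.
have /choice[C CE] (i : 'I_(size t)) := tsp i (ltn_ord i).
pose ext n (u : 'rV[F]_n) (i : nat) :=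
  if insub i is Some j then u 0 (j : 'I_n) else 0.
have extE n (u : 'rV[F]_n) (j : 'I_n) : ext n u j = u 0 j by rewrite /ext valK.
(* Both matrices have the same entries: [M] is typed as square, to have a determinant and an
   inverse, and [N] has its columns indexed by [s]. *)
pose M := \matrix_(i < size t, j < size t) C i j.
pose N := \matrix_(i < size t, j < size s) C i j.
have tN (i : 'I_(size t)) : t`_i = \sum_j N i j *: s`_j.
  by rewrite CE; apply: eq_bigr => j _; rewrite mxE.
have Munit : M \in unitmx.
  rewrite unitmxE unitfE; apply/det0P => -[u u0 uM].
  case/negP: u0; apply/eqP/rowP => i; rewrite mxE -extE; apply: indt => //.
  rewrite (@comb_comb s t _ N (fun=> 0)) ?comb0 // => j.
  move/rowP/(_ (cast_ord st j)): uM; rewrite !mxE => uM.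
  by rewrite -[RHS]uM; apply: eq_bigr => k _; rewrite !mxE extE.
pose r : 'rV_(size t) := \row_i c i.
pose u := r *m invmx M.
have u0 : u = 0.
  apply/rowP => i; rewrite [RHS]mxE -extE; apply: indt => //.
  rewrite -c0; apply: (@comb_comb s t _ N c) => // j.
  have /rowP/(_ (cast_ord st j)) : u *m M = r by rewrite /u mulmxKV.
  rewrite !mxE => <-.
  by apply: eq_bigr => k _; rewrite extE !mxE.
move=> i lt_is; have : r = 0 by rewrite -(mulmxKV Munit r) -/u u0 mul0mx.
by rewrite st in lt_is => /rowP/(_ (Ordinal lt_is)); rewrite !mxE.
Qed.

Lemma finite_rankD U (X Y : U -> V) :
  finite_rank X -> finite_rank Y -> finite_rank (fun x => X x + Y x).
Proof.
move=> [s sX] [t tY]; exists (s ++ t) => x.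
by apply: spannedD; [apply: spanned_catl|apply: spanned_catr].
Qed.

Lemma finite_rankZ U (X : U -> V) a :
  finite_rank X -> finite_rank (fun x => a *: X x).
Proof. by move=> [s sX]; exists s => x; apply: spannedZ. Qed.

End LinearCombinations.

(** * Inner products *)

Section HilbertSpace.
Variables (R : realType) (H : hilbertType R).
Implicit Types (x y z : H) (s : seq H) (a b k : R[i]).

Lemma innerDl x y z : inner (x + y) z = inner x z + inner y z.
Proof. exact: linearDl. Qed.

Lemma innerDr x y z : inner x (y + z) = inner x y + inner x z.
Proof. exact: linearDr. Qed.

Lemma innerZl a x y : inner (a *: x) y = a * inner x y.
Proof. by rewrite linearZl_LR. Qed.

Lemma innerZr a x y : inner x (a *: y) = a^* * inner x y.
Proof. by rewrite linearZr. Qed.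

Lemma innerNl x y : inner (- x) y = - inner x y.
Proof. exact: linearNl. Qed.

Lemma innerNr x y : inner x (- y) = - inner x y.
Proof. exact: linearNr. Qed.

Lemma inner0l x : inner 0 x = 0.
Proof. exact: linear0l. Qed.

Lemma inner0r x : inner x 0 = 0.
Proof. exact: linear0r. Qed.

Lemma innerC x y : inner x y = (inner y x)^*.
Proof. by rewrite hermC /= expr0 mul1r. Qed.

Lemma inner_suml (I : finType) (f : I -> H) y :
  inner (\sum_i f i) y = \sum_i inner (f i) y.
Proof. exact: linear_sumlz. Qed.

Lemma inner_combl c s y :
  inner (comb c s) y = \sum_(i < size s) c i * inner s`_i y.
Proof. by rewrite inner_suml; apply: eq_bigr => i _; rewrite innerZl. Qed.

Lemma inner_combr c s y :
  inner y (comb c s) = \sum_(i < size s) (c i)^* * inner y s`_i.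
Proof.
rewrite innerC inner_combl rmorph_sum; apply: eq_bigr => i _.
by rewrite rmorphM /= -innerC.
Qed.

Lemma inner_eq0 x : inner x x = 0 -> x = 0.
Proof.
by rewrite inner_norm => /eqP; rewrite expf_eq0 /= normr_eq0 => /eqP.
Qed.

Lemma inner_injr x y : (forall z, inner z x = inner z y) -> x = y.
Proof.
move=> xy; apply/eqP; rewrite -subr_eq0; apply/eqP/inner_eq0.
by rewrite innerDr innerNr xy subrr.
Qed.

Lemma inner_injl x y : (forall z, inner x z = inner y z) -> x = y.
Proof. by move=> xy; apply: inner_injr => z; rewrite innerC xy -innerC. Qed.

(** The test vectors [u] are free: one choice with nonzero determinant proves [s] independent. The
    Gram matrix proper is the case where [u] enumerates [s]. *)
Definition gram s (u : nat -> H) := \matrix_(i < size s, j < size s) inner s`_i (u j).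

Lemma gram_indep s u : \det (gram s u) != 0 -> indep s.
Proof.
move=> det0 c c0 i lt_is; apply: contraNeq det0 => ci; apply/det0P.
exists (\row_i c i).
  by apply: contra ci => /eqP/rowP/(_ (Ordinal lt_is)); rewrite !mxE => ->.
apply/rowP => j; rewrite !mxE -[RHS](inner0l (u j)) -c0 inner_combl.
by apply: eq_bigr => k _; rewrite !mxE.
Qed.

(** A row in the left kernel gives a combination of [s] orthogonal to every member of [s], hence to
    itself. *)
Lemma indep_gram s : indep s -> \det (gram s (nth 0 s)) != 0.
Proof.
move=> inds; apply/det0P => -[u u0 uG].
pose c (n : nat) := if insub n is Some j then u 0 (j : 'I_(size s)) else 0.
have cE (j : 'I_(size s)) : c j = u 0 j by rewrite /c valK.
have c0 : comb c s = 0.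
  apply: inner_eq0; rewrite inner_combr big1 // => j _; rewrite inner_combl.
  move/rowP/(_ j): uG; rewrite !mxE.
  by under eq_bigr => i _ do rewrite !mxE -cE; move=> ->; rewrite mulr0.
case/negP: u0; apply/eqP/rowP => j; rewrite mxE -cE; exact: (inds c c0).
Qed.

(** The determinant of the products of s_i + t u_i with s_j is a polynomial in t, nonzero at t = 0,
    so it has finitely many roots. *)
Lemma indep_perturb s (u : nat -> H) : indep s ->
  exists2 t : R[i], t != 0 &
    indep (mkseq (fun i => s`_i + t *: u i) (size s)).
Proof.
move=> /indep_gram; pose v := nth 0 s.
pose PM : 'M[{poly R[i]}]_(size s) :=
  \matrix_(i, j) ((inner (v i) (v j))%:P + (inner (u i) (v j)) *: 'X).
have hornerPM t : (\det PM).[t] =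
    \det (\matrix_(i < size s, j < size s) inner (v i + t *: u i) (v j)).
  rewrite -horner_evalE -det_map_mx; congr (\det _); apply/matrixP => i j.
  by rewrite !mxE /= ?horner_evalE !hornerE innerDl innerZl mulrC.
(* The factor ['X] forces a non-root of the product to be nonzero. *)
move=> det0; have : \det PM * 'X != 0.
  rewrite mulf_neq0 ?polyX_eq0 //; apply: contra_neq det0 => PM0.
  have := hornerPM 0; rewrite PM0 horner0 => ->; congr (\det _).
  by apply/matrixP => i j; rewrite !mxE scale0r addr0.
set q := _ * 'X => q0.
have [t qt0] : exists t, q.[t] != 0.
  apply: contrapT => /forallNP q_eq0.
  pose rs : seq R[i] := [seq i%:R | i <- iota 0 (size q)].
  have roots : all (root q) rs.
    by apply/allP => _ /mapP[i _ ->]; apply/negPn/negP => /q_eq0.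
  have urs : uniq rs.
    by rewrite map_inj_uniq ?iota_uniq // => i j /eqP; rewrite eqr_nat => /eqP.
  by have := max_poly_roots q0 roots urs; rewrite size_map size_iota ltnn.
move: qt0; rewrite hornerM hornerX mulf_eq0 negb_or hornerPM => /andP[dt t0].
exists t => //.
have ss : size (mkseq (fun i => s`_i + t *: u i) (size s)) = size s.
  by rewrite size_mkseq.
apply: (gram_indep (u := v)); rewrite /gram.
move: dt; congr (is_true (_ != _)); rewrite ss.
by congr (\det _); apply/matrixP => i j; rewrite !mxE nth_mkseq.
Qed.

(* If A x = \sum_i c_i B_i x, put C = A - \sum_i c_i B_i, which kills x, and choose
   y with C y outside the span of the B_i x: then C (x + t y) = t C y, and the
   vectors B_i (x + t y), C (x + t y) are independent for some t. *)
Lemma indep_extend (A : {linear H -> H}) (Bs : seq {linear H -> H}) x :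
  indep [seq B x | B : {linear H -> H} <- Bs] ->
  (forall c, ~ finite_rank
     (fun y => A y - comb c [seq B y | B : {linear H -> H} <- Bs])) ->
  exists z, indep (A z :: [seq B z | B : {linear H -> H} <- Bs]).
Proof.
pose ev y := [seq B y | B : {linear H -> H} <- Bs]; rewrite -/(ev x).
move=> indB fA; have [[c Ax]|nA] := pselect (spanned (ev x) (A x)); last first.
  by exists x; apply: indep_cons.
have /existsNP[y Cy] : ~ forall y, spanned (ev x) (A y - comb c (ev y)).
  by move=> sp; apply: (fA c); exists (ev x).
have [t t0] := indep_perturb (fun i => if i is j.+1 then (ev y)`_j else 0)
  (indep_cons Cy indB).
have combP : comb c (ev (x + t *: y)) = comb c (ev x) + t *: comb c (ev y).
  rewrite /comb !size_map scaler_sumr -big_split /=; apply: eq_bigr => i _.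
  rewrite !(nth_map (\0 : {linear H -> H})) // linearD linearZ scalerDr.
  by rewrite !scalerA mulrC.
set w := A y - _ => indt.
exists (x + t *: y); rewrite -[A _](subrK (comb c (ev (x + t *: y)))).
apply: indep_shear; have -> : A (x + t *: y) - comb c (ev (x + t *: y)) = t *: w.
  by rewrite combP linearD linearZ Ax /w scalerBr opprD addrACA subrr add0r.
apply: indep_scale => //; move: indt.
rewrite /mkseq /= scaler0 addr0 (iotaDl 1 0) -map_comp.
congr (indep (_ :: _)); apply: (@eq_from_nth _ 0).
  by rewrite !size_map size_iota.
move=> i; rewrite size_map size_iota => lt_i; rewrite (nth_map 0%N) ?size_iota //.
move: (lt_i); rewrite size_map => lt_iB.
rewrite nth_iota //= add0n !(nth_map (\0 : {linear H -> H})) //.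
by rewrite linearD linearZ.
Qed.

Definition adjoint_pair (X Y : H -> H) := forall x y, inner (X x) y = inner x (Y y).

(** Gram-Schmidt by induction on [s]: [z'] and [r] are the parts of [z] and [a] orthogonal to the
    tail, and the component of [z'] along [r] is removed. If [r] is 0, then [a] already lies in the
    span of the tail. *)
Lemma orthogonal_projection s z :
  exists c, forall i, (i < size s)%N -> inner (z - comb c s) s`_i = 0.
Proof.
elim: s z => [|a s IHs] z; first by exists (fun=> 0).
have [c cP] := IHs z; have [d dP] := IHs a.
set z' := z - _ in cP; set r := a - _ in dP.
pose m := inner z' r / inner r r.
exists (fun j => if j is i.+1 then c i - m * d i else m).
have -> : z - comb (fun j => if j is i.+1 then c i - m * d i else m) (a :: s)
    = z' - m *: r.
  rewrite comb_cons /= (_ : comb _ s = comb c s - m *: comb d s).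
    rewrite /z' /r scalerBr !opprD !opprK !addrA; congr (_ + _).
    by rewrite -!addrA; congr (_ + _); rewrite addrC.
  rewrite -combZ -[X in _ = _ + X]scaleN1r -combZ -combD.
  by apply: eq_comb => i _ /=; rewrite mulN1r.
have orth_s i : (i < size s)%N -> inner (z' - m *: r) s`_i = 0.
  by move=> lt_is; rewrite innerDl innerNl innerZl cP ?dP // mulr0 subrr.
move=> [_|i]; last exact: orth_s.
rewrite [nth _ _ _]/= -[a](subrK (comb d s)) -/r innerDr inner_combr.
rewrite big1 => [|i _]; last by rewrite orth_s ?mulr0.
rewrite addr0 innerDl innerNl innerZl /m.
have [/inner_eq0 ->|r0] := eqVneq (inner r r) 0; first by rewrite !inner0r mulr0 subrr.
by rewrite divfK // subrr.
Qed.

(** If z is orthogonal to the list [s] spanning the range of [X], then |Y z|^2 = <X (Y z), z> = 0.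
    Hence the images of [s] under [Y] span the range of [Y]. *)
Lemma finite_rank_adjoint (X Y : {linear H -> H}) :
  adjoint_pair X Y -> finite_rank X -> finite_rank Y.
Proof.
move=> XY [s sX]; exists [seq Y x | x <- s] => z.
have [c cP] := orthogonal_projection s z.
have Y0 : Y (z - comb c s) = 0.
  apply: inner_eq0; rewrite -XY.
  have [d ->] := sX (Y (z - comb c s)); rewrite inner_combl big1 // => i _.
  by rewrite innerC cP // rmorph0 mulr0.
exists c; rewrite -[z in LHS](subrK (comb c s)) linearD Y0 add0r /comb linear_sum.
rewrite size_map; apply: eq_bigr => i _; rewrite linearZ /= (nth_map 0) //.
Qed.

Lemma not_indep s : ~ indep s ->
  exists2 c, comb c s = 0 & exists2 i, (i < size s)%N & c i != 0.
Proof.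
move=> /existsNP[c] /not_implyP[c0 nc]; exists c => //.
by apply: contrapT => nex; apply: nc => i lt_is; apply: contrapT => /eqP ci;
  apply: nex; exists i.
Qed.

End HilbertSpace.

Definition innerE (R : realType) (H : hilbertType R) :=
  (@innerDl R H, @innerDr R H, @innerNl R H, @innerNr R H,
   @innerZl R H, @innerZr R H, @inner0l R H, @inner0r R H).

Ltac inner_ring := apply: inner_injl => ?; rewrite /= !innerE; ring.

(** * Local linear dependence of operators *)

Section LocalDependence.
Variables (R : realType) (H : hilbertType R).
Implicit Types (x y z : H) (a b k : R[i]).
Implicit Types (As Bs : seq {linear H -> H}).

Local Notation nth_op := (nth (\0 : {linear H -> H})).

Definition evals Bs x := [seq B x | B : {linear H -> H} <- Bs].

(** Linear independence in the quotient of the operators by those of finite rank. *)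
Definition indep_mod_finite_rank As := forall c,
  finite_rank (fun y => comb c (evals As y)) ->
  forall i, (i < size As)%N -> c i = 0.

Lemma finite_rank_comb c Bs :
  (forall i, (i < size Bs)%N -> finite_rank (nth_op Bs i)) ->
  finite_rank (fun y => comb c (evals Bs y)).
Proof.
elim: Bs c => [|B Bs IHs] c fB.
  by exists [::] => y; rewrite comb_nil; apply: spanned0.
have := finite_rankD (finite_rankZ (c 0%N) (fB 0%N isT))
  (IHs (c \o succn) (fun i => fB i.+1)).
by move=> [s sP]; exists s => y; rewrite comb_cons; apply: sP.
Qed.

Lemma finite_rank_eq (X Y : H -> H) : X =1 Y -> finite_rank X -> finite_rank Y.
Proof. by move=> XY [s sX]; exists s => x; rewrite -XY. Qed.

Lemma indep_mod_finite_rank_cons (A : {linear H -> H}) As :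
  (forall c, ~ finite_rank (fun y => A y + comb c (evals As y))) ->
  indep_mod_finite_rank As -> indep_mod_finite_rank (A :: As).
Proof.
move=> nA indA c fc; have c0 : c 0%N = 0.
  apply/eqP/negPn/negP => c0; apply: (nA ((c 0%N)^-1 \*o (c \o succn))).
  apply: finite_rank_eq (finite_rankZ (c 0%N)^-1 fc) => x.
  by rewrite comb_cons scalerDr scalerA mulVf // scale1r combZ.
case=> [|i] lt_i //; apply: (indA (c \o succn)) => //.
by apply: finite_rank_eq fc => x; rewrite comb_cons c0 scale0r add0r.
Qed.

Lemma indep_extends As Bs x : indep_mod_finite_rank As ->
  (forall i, (i < size Bs)%N -> finite_rank (nth_op Bs i)) ->
  indep (evals Bs x) -> exists z, indep (evals (As ++ Bs) z).
Proof.
move=> + fB indB; elim: As => [|A As IHs] indA; first by exists x.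
have [|z indz] := IHs.
  move=> c fc i lt_i; apply: (indA (fun j => if j is k.+1 then c k else 0) _ i.+1) => //.
  case: fc => s sP; exists s => y; rewrite comb_cons scale0r add0r; exact: sP.
apply: indep_extend indz _ => c fc.
(* Cancelling the terms from [Bs] keeps the rank finite; what remains is a combination of [A :: As]
   with leading coefficient 1. *)
pose d (i : nat) := if i is j.+1 then - c j else 1.
suff /(_ 0%N isT)/eqP : forall i, (i < size (A :: As))%N -> d i = 0.
  by rewrite oner_eq0.
apply: indA.
have := finite_rankD fc (finite_rank_comb (fun i => c (i + size As)%N) fB).
move=> [s sP]; exists s => y; move: (sP y); congr (spanned s _).
rewrite comb_cons scale1r -addrA; congr (_ + _).
rewrite -/(evals _ _) /evals map_cat.
rewrite (@eq_comb _ _ c (fun i => if (i < size (evals As y))%N then c i else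
   c (i - size (evals As y) + size As)%N)); last first.
  by move=> i _; case: ltnP => //; rewrite size_map => le_i; rewrite subnK.
rewrite (comb_cat c (fun i => c (i + size As)%N)) opprD subrK -scaleN1r -combZ.
by apply: eq_comb => i _; rewrite /= mulN1r.
Qed.

(** Otherwise [As ++ Bs] is independent at some vector, and [indep_exchange] carries this over to
    [Ws]. In this way the local dependence of I, T, S, S T passes to the finite-rank operators in
    their span. *)
Lemma no_local_indep (Ws As Bs : seq {linear H -> H}) :
  (forall x, ~ indep (evals Ws x)) -> size Ws = size (As ++ Bs) ->
  (forall i, (i < size (As ++ Bs))%N ->
     forall x, spanned (evals Ws x) (evals (As ++ Bs) x)`_i) ->
  indep_mod_finite_rank As ->
  (forall i, (i < size Bs)%N -> finite_rank (nth_op Bs i)) ->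
  forall x, ~ indep (evals Bs x).
Proof.
move=> depW szW spW indA fB x /(indep_extends indA fB)[z indz].
apply: (depW z); apply: indep_exchange indz _ _; first by rewrite !size_map.
by move=> i; rewrite size_map => lt_i; apply: spW.
Qed.

End LocalDependence.

(** * Locally dependent pairs of symmetric operators *)

Section SymmetricPairs.
Variables (R : realType) (H : hilbertType R).
Implicit Types (x y z v : H).

Lemma line_valued_symmetric (X : H -> H) v : adjoint_pair X X -> v != 0 ->
  (forall x, exists l, X x = l *: v) ->
  exists a : R[i], forall x, X x = (a * inner x v) *: v.
Proof.
move=> XX v0 Xv; have [l lE] := Xv v.
have vv0 : inner v v != 0 by apply: contra_neq v0 => /inner_eq0.
exists (l^* / inner v v) => x; have [m mE] := Xv x; rewrite mE.
have := XX x v; rewrite mE lE innerZl innerZr => mE'.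
by rewrite mulrAC -mE' mulfK.
Qed.

(* If X and Y are locally dependent and X x0 = v is nonzero, comparing x0 + y with
   x0 - y shows that both are valued in the line spanned by v; a symmetric such
   operator is a multiple of x |-> <x, v> v. *)
Lemma symmetric_locally_dependent (X Y : {linear H -> H}) :
  adjoint_pair X X -> adjoint_pair Y Y ->
  (forall x, ~ indep [:: X x; Y x]) ->
  exists a b : R[i], ((a != 0) || (b != 0)) /\ forall x, a *: X x + b *: Y x = 0.
Proof.
move=> XX YY dep.
have [[x0 /eqP v0]|X0] := pselect (exists x, X x <> 0); last first.
  exists 1, 0; rewrite oner_eq0; split=> // x.
  by rewrite scale0r addr0 scale1r; apply: contrapT => nX; apply: X0; exists x.
have {}dep x : exists a b : R[i],
    ((a != 0) || (b != 0)) /\ a *: X x + b *: Y x = 0.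
  have [c] := not_indep (dep x); rewrite !comb_cons comb_nil addr0 => c0 ci.
  exists (c 0%N), (c 1%N); split=> //.
  by case: ci => -[|[|//]] _ ->; rewrite ?orbT.
set v := X x0 in v0.
have [k kE] : exists k, Y x0 = k *: v.
  have [a [b [ab abE]]] := dep x0.
  have b0 : b != 0.
    apply: contraTneq ab => b0; move: abE; rewrite b0 scale0r addr0 => /eqP.
    by rewrite scaler_eq0 (negbTE v0) orbF eqxx orbF negbK.
  exists (- (a / b)); move/eqP: abE; rewrite addrC addr_eq0 => /eqP abE.
  by rewrite -[LHS]scale1r -(mulVf b0) -scalerA abE scalerN scalerA scaleNr mulrC.
pose C x := Y x - k *: X x.
have CD x y : C (x + y) = C x + C y.
  by apply: inner_injl => z; rewrite /C (linearD X) (linearD Y) !innerE; ring.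
have CN x : C (- x) = - C x 
  by apply: inner_injl => z; rewrite /C (linearN X) (linearN Y) !innerE; ring.
have Cx0 : C x0 = 0 by rewrite /C kE subrr.
have XC x : C x != 0 -> exists m, X x = m *: C x.
  move=> Cx; have [a [b [ab abE]]] := dep x.
  have abE' : (a + b * k) *: X x + b *: C x = 0.
    by rewrite -abE /C; apply: inner_injl => z; rewrite !innerE; ring.
  have ak : a + b * k != 0.
    apply: contraTneq ab => ak; move: abE'; rewrite ak scale0r add0r => /eqP.
    rewrite scaler_eq0 (negbTE Cx) orbF => /eqP b0.
    by move: ak; rewrite b0 mul0r addr0 => ->; rewrite eqxx.
  exists (- (b / (a + b * k))); move/eqP: abE'; rewrite addr_eq0 => /eqP abE'.
  by rewrite -[LHS]scale1r -(mulVf ak) -scalerA abE' scalerN scalerA scaleNr mulrC.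
have Cv y : exists l, C y = l *: v.
  have [->|Cy] := eqVneq (C y) 0; first by exists 0; rewrite scale0r.
  have [|m1 m1E] := XC (x0 + y); first by rewrite CD Cx0 add0r.
  have [|m2 m2E] := XC (x0 - y); first by rewrite CD CN Cx0 add0r oppr_eq0.
  rewrite CD Cx0 add0r in m1E; rewrite CD CN Cx0 add0r in m2E.
  pose m := (m1 - m2) / 2; have vE : v = m *: C y.
    have : X (x0 + y) + X (x0 - y) = 2 *: v.
      rewrite !(linearD X) (linearN X) -/v; apply: inner_injl => z.
      by rewrite !innerE; ring.
    rewrite m1E m2E scalerN -scalerBl => vE.
    by rewrite /m mulrC -scalerA vE scalerA mulVf ?pnatr_eq0 // scale1r.
  exists m^-1; rewrite vE scalerA mulVf ?scale1r //.
  by apply: contra_neq v0 => m0; rewrite vE m0 scale0r.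
have [[y0 /eqP Cy0]|C0] := pselect (exists y, C y <> 0); last first.
  exists (- k), 1; rewrite oner_eq0 orbT; split=> // x.
  rewrite scale1r scaleNr addrC -/(C x).
  by apply: contrapT => nC; apply: C0; exists x.
have Xv x : exists l, X x = l *: v.
  have XCv y : C y != 0 -> exists l, X y = l *: v.
    by move=> /XC[m ->]; have [l ->] := Cv y; exists (m * l); rewrite scalerA.
  (* At a zero of [C], translating by [y0] reaches a point where [C] does not vanish. *)
  have [C0|/XCv//] := eqVneq (C x) 0.
  have [|l1 l1E] := XCv (x + y0); first by rewrite CD C0 add0r.
  have [l2 l2E] := XCv _ Cy0; exists (l1 - l2).
  by rewrite scalerBl -l1E -l2E linearD addrK.
have Yv x : exists l, Y x = l *: v.
  have [l lE] := Xv x; have [m mE] := Cv x; exists (m + k * l).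
  by rewrite scalerDl -mE -scalerA -lE subrK.
have [a aE] := line_valued_symmetric XX v0 Xv.
have [b bE] := line_valued_symmetric YY v0 Yv.
exists b, (- a); split=> [|x]; last first.
  by rewrite aE bE; apply: inner_injl => z; rewrite !innerE; ring.
rewrite oppr_eq0 orbC; apply/orP; left; apply: contra_neq v0 => a0.
by rewrite /v aE a0 mul0r scale0r.
Qed.

End SymmetricPairs.

(** * Diagonalization in finite rank *)

Section OperatorPolynomials.
Variables (K : fieldType) (V : lmodType K) (F : {linear V -> V}).
Implicit Types (p q : {poly K}) (y : V).

Definition op_horner p y := \sum_(i < size p) p`_i *: iter i F y.

Lemma op_horner_wide n p y : (size p <= n)%N ->
  op_horner p y = \sum_(i < n) p`_i *: iter i F y.
Proof.
move=> le_pn.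
rewrite /op_horner (big_ord_widen n (fun i => p`_i *: iter i F y) le_pn) big_mkcond.
by apply: eq_bigr => i _; case: ltnP => // le_pi; rewrite nth_default // scale0r.
Qed.

Lemma op_horner_mulXsub p r y :
  op_horner (p * ('X - r%:P)) y = F (op_horner p y) - r *: op_horner p y.
Proof.
have le_s : (size (p * ('X - r%:P))%R <= (size p).+1)%N.
  by rewrite (leq_trans (size_mul_leq _ _)) // size_XsubC addn2.
rewrite (op_horner_wide y le_s) [in X in r *: X](op_horner_wide y (leqnSn (size p))).
rewrite scaler_sumr mulrBr; under eq_bigr => i _ do
  rewrite coefB coefMX coefMC scalerBl.
rewrite sumrB; congr (_ - _); last first.
  by apply: eq_bigr => i _; rewrite scalerA mulrC.
rewrite big_ord_recl /= scale0r add0r linear_sum; apply: eq_bigr => i _.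
by rewrite linearZ.
Qed.

End OperatorPolynomials.

Section Eigenvectors.
Variables (R : realType) (H : hilbertType R).
Implicit Types (x y z : H) (a b k r : R[i]).

(** Induction on the size of [q], which cannot be constant since F y is nonzero. Write q = p (X -
    r): either F (p(F) y) is an eigenvector for r, or it is 0 and p replaces q. *)
Lemma exists_eigenvector (F : {linear H -> H}) (q : {poly R[i]}) y :
  F y != 0 -> q != 0 -> F (op_horner F q y) = 0 ->
  exists p r, let w := F (op_horner F p y) in w != 0 /\ F w = r *: w.
Proof.
move=> Fy; have [n le_qn] := ubnP (size q); elim: n q le_qn => // n IHn q le_qn q0 Fq.
have [sq1|sq1] := eqVneq (size q) 1%N.
  have /eqP := sq1; rewrite size_poly_eq1 => /eqpf_eq[k k0 qk].
  move/eqP: Fq; rewrite qk (@op_horner_wide _ _ F 1) ?alg_polyC ?size_polyC_leq1 //.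
  rewrite big_ord1 coefC eqxx linearZ scaler_eq0 (negbTE k0) /= => Fy0.
  by rewrite Fy0 in Fy.
have [r /factor_theorem[p qE]] := closed_rootP _ sq1.
have p0 : p != 0 by apply: contraNneq q0 => p0; rewrite qE p0 mul0r.
have [Fp|Fp] := eqVneq (F (op_horner F p y)) 0.
  apply: IHn Fp => //; rewrite -ltnS (leq_trans _ le_qn) // qE.
  by rewrite size_Mmonic ?monicXsubC // size_XsubC addn2.
exists p, r; split=> //; apply/eqP; rewrite -subr_eq0 -linearZ -linearB.
by rewrite -op_horner_mulXsub -qE Fq.
Qed.

Definition eigen_adjoint (F S : H -> H) := forall k x, F x = k *: x -> S x = k^* *: x.

Variables (F S : {linear H -> H}).
Hypotheses (FS : adjoint_pair F S) (FS_eigen : eigen_adjoint F S).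

Definition orthogonal_to (e : seq H) x := forall i, (i < size e)%N -> inner x e`_i = 0.

(** Eigenvalues are nonzero so that the eigenvectors lie in the range of [F], which bounds their
    number when [F] has finite rank. *)
Definition eigen_system (e : seq H) := [/\
  forall i, (i < size e)%N -> e`_i != 0,
  forall i j, (i < size e)%N -> (j < size e)%N -> i != j -> inner e`_i e`_j = 0 &
  forall i, (i < size e)%N -> exists2 p, p != 0 & F e`_i = p *: e`_i ].

Lemma orthogonal_indep (e : seq H) : (forall i, (i < size e)%N -> e`_i != 0) ->
  (forall i j, (i < size e)%N -> (j < size e)%N -> i != j -> inner e`_i e`_j = 0) ->
  indep e.
Proof.
move=> e0 oe c c0 i lt_ie; have : inner (comb c e) e`_i = 0 by rewrite c0 inner0l.
rewrite inner_combl.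
rewrite (bigD1 (Ordinal lt_ie)) //= big1 ?addr0; last first.
  by move=> j nji; rewrite oe ?mulr0.
move/eqP; rewrite mulf_eq0 => /orP[/eqP//|/eqP/inner_eq0 ei].
by have := e0 i lt_ie; rewrite ei eqxx.
Qed.

Lemma eigen_system_size (s e : seq H) : (forall x, spanned s (F x)) ->
  eigen_system e -> (size e <= size s)%N.
Proof.
move=> sF [e0 oe eF]; apply: steinitz (orthogonal_indep e0 oe) _ => i lt_ie.
have [p p0 Fe] := eF i lt_ie.
rewrite -[e`_i]scale1r -(mulVf p0) -scalerA -Fe; exact/spannedZ/sF.
Qed.

(** By [FS_eigen] each e_i is also an eigenvector of [S], so <F x, e_i> = <x, S e_i> is a multiple
    of <x, e_i>. *)
Lemma orthogonal_to_stable e x : eigen_system e -> orthogonal_to e x ->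
  orthogonal_to e (F x).
Proof.
move=> [_ _ eF] ox i lt_ie; have [p _ Fe] := eF i lt_ie.
by rewrite FS (FS_eigen Fe) innerZr ox ?mulr0.
Qed.

Lemma orthogonal_to_horner e q x : eigen_system e -> orthogonal_to e x ->
  orthogonal_to e (op_horner F q x).
Proof.
move=> ee ox i lt_ie; rewrite inner_suml big1 // => j _; rewrite innerZl.
suff -> : inner (iter j F x) e`_i = 0 by rewrite mulr0.
move: i lt_ie; rewrite -/(orthogonal_to e _).
by elim: (nat_of_ord j) => //= k /(orthogonal_to_stable ee).
Qed.

(** The vectors F x, F^2 x, ... lie in the finite-dimensional range of [F], and a relation between
    them is a polynomial [q] with F (q(F) x) = 0. The eigenvector that it provides stays orthogonal
    to [e]. *)
Lemma eigen_system_extend e x : finite_rank F -> eigen_system e ->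
  orthogonal_to e x -> F x != 0 -> exists w, eigen_system (w :: e).
Proof.
move=> [s sF] ee ox Fx.
have /not_indep[c c0 [i lt_i ci]] :
    ~ indep (mkseq (fun i => iter i F (F x)) (size s).+1).
  move=> /(steinitz (s := s)); rewrite size_mkseq ltnn => /(_ _)/notF; apply.
  by move=> i lt_i; rewrite nth_mkseq // -iterSr; apply: sF.
rewrite size_mkseq in lt_i.
pose q := \poly_(i < (size s).+1) c i.
have q0 : q != 0.
  by apply: contraNneq ci => /polyP/(_ i); rewrite coef_poly lt_i coef0 => ->.
have Fq : F (op_horner F q x) = 0.
  rewrite (op_horner_wide F x (size_poly _ _)) linear_sum -[RHS]c0 /comb.
  rewrite size_mkseq; apply: eq_bigr => j _; rewrite linearZ coef_poly ltn_ord.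
  by rewrite nth_mkseq // -iterSr.
have [p [r [w0 Fw]]] := exists_eigenvector Fx q0 Fq.
set y := op_horner F p x in w0 Fw; set w := F y in w0 Fw.
have oy : orthogonal_to e y by apply: orthogonal_to_horner.
have ow : orthogonal_to e w by apply: orthogonal_to_stable.
(* As w = F y, r = 0 would give <w, w> = <y, S w> = 0. *)
have r0 : r != 0.
  apply: contra_neq w0 => r0; apply: inner_eq0.
  by rewrite (FS y w : inner w w = _) (FS_eigen Fw) r0 conjC0 scale0r inner0r.
case: ee => e0 oe eF; exists w; split.
- by case.
- move=> [|j] [|k] //= lt_j lt_k jk; first exact: ow.
    by rewrite innerC ow ?conjC0.
  exact: oe.
- by case=> [|j lt_j]; [exists r|apply: eF].
Qed.

(** Eigen systems have bounded size, so extending them must stop, which happens only when [F]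
    vanishes on the orthogonal complement. *)
Lemma finite_rank_diagonal : finite_rank F ->
  exists2 e, eigen_system e & forall x, orthogonal_to e x -> F x = 0.
Proof.
move=> fF; apply: contrapT => ndiag.
have ext e : eigen_system e -> exists w, eigen_system (w :: e).
  move=> ee; apply: contrapT => next; apply: ndiag; exists e => // x ox.
  by apply: contrapT => /eqP Fx; apply: next; apply: eigen_system_extend ox Fx.
have [s sF] := fF.
have [e ee se] : exists2 e, eigen_system e & size e = (size s).+1.
  elim: (size s).+1 => [|n [e ee se]]; first by exists [::].
  by have [w ew] := ext e ee; exists (w :: e); rewrite //= se.
by have := eigen_system_size sF ee; rewrite se ltnn.
Qed.

(** The relation at the sum [v] of the eigenvectors holds everywhere: the corresponding operator [G]
    is diagonal on [e], and G v = 0 makes each of its eigenvalues vanish by independence of [e]. *)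
Lemma finite_rank_local_relation : finite_rank F ->
  (forall x, ~ indep [:: F x; S x; S (F x)]) ->
  exists2 c : nat -> R[i], exists2 i, (i < 3)%N & c i != 0 &
    forall x, comb c [:: F x; S x; S (F x)] = 0.
Proof.
move=> /finite_rank_diagonal[e ee Fe] dep.
pose v := comb (fun=> 1) e.
have [c cv ci] := not_indep (dep v); exists c => // x.
pose G : {linear H -> H} := c 0%N \*: F \+ (c 1%N \*: S \+ c 2%N \*: (S \o F)).
have GE y : comb c [:: F y; S y; S (F y)] = G y.
  by rewrite !comb_cons comb_nil addr0.
have G_comb d : G (comb d e) = \sum_(i < size e) d i *: G e`_i.
  by rewrite linear_sum; apply: eq_bigr => i _; rewrite linearZ.
have [e0 oe eF] := ee.
have /choice[m mE] (i : 'I_(size e)) : exists m, G e`_i = m *: e`_i.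
  have [p _ Fp] := eF i (ltn_ord i).
  exists (c 0%N * p + c 1%N * p^* + c 2%N * (p * p^*)).
  have Sp : S (p *: e`_i) = p *: S e`_i by rewrite linearZ.
  rewrite /G /= Fp Sp (FS_eigen Fp).
  by apply: inner_injl => z; rewrite !innerE; ring.
have Ge (i : 'I_(size e)) : G e`_i = 0.
  rewrite mE; pose m' (j : nat) := if insub j is Some k then m k else 0.
  have m'E (j : 'I_(size e)) : m' j = m j by rewrite /m' valK.
  rewrite -m'E (orthogonal_indep e0 oe (c := m')) ?scale0r //.
  rewrite -[RHS]cv GE G_comb; apply: eq_bigr => j _.
  by rewrite scale1r mE m'E.
have [d dP] := orthogonal_projection e x.
rewrite GE -(subrK (comb d e) x) linearD G_comb big1 ?addr0; last first.
  by move=> i _; rewrite Ge scaler0.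
(* On the orthogonal complement of [e], [F] vanishes, and so does [S] by [FS_eigen] for the
   eigenvalue 0. *)
have F0 := Fe _ dP; have := @FS_eigen 0 (x - comb d e).
rewrite scale0r conjC0 scale0r => /(_ F0) S0.
by rewrite /G /= F0 S0 (linear0 S) !scaler0 !addr0.
Qed.

End Eigenvectors.

(** * The quadratic relation *)

(** If e = 1 fails, then b^* = -a and e = i gives 2 i a. The sum of e (a T + b S) and its adjoint
    then has a nonzero coefficient at T. *)
Lemma exists_phase (R : realType) (a b : R[i]) : (a != 0) || (b != 0) ->
  exists e, e * a + (e * b)^* != 0.
Proof.
move=> ab; have [ab0|] := eqVneq (a + b^* ) 0; last by exists 1; rewrite !mul1r.
have bE : b^* = - a by apply/eqP; rewrite -addr_eq0 addrC ab0.
have a0 : a != 0.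
  apply: contraTneq ab => a0; rewrite -(conjC_eq0 b) bE a0.
  by rewrite oppr0 eqxx.
exists 'i; rewrite rmorphM /= bE conjCi mulrNN -mulr2n -mulr_natl.
by rewrite !mulf_neq0 ?neq0Ci ?pnatr_eq0.
Qed.

Section OperatorRelation.
Variables (R : realType) (H : hilbertType R).
Implicit Types (x y z : H) (a b c d g : R[i]).

Variables (T S : {linear H -> H}).
Hypotheses (TS : adjoint_pair T S) (TS_eigen : eigen_adjoint T S).
Hypothesis id_infinite : ~ finite_rank (@idfun H).
Hypothesis dep : forall x, ~ indep [:: x; T x; S x; S (T x)].

Definition op_relation := exists a b c d, [|| a != 0, b != 0, c != 0 | d != 0] /\
  forall x, a *: x + b *: T x + c *: S x + d *: S (T x) = 0.

Let Q : {linear H -> H} := S \o T.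
Let I : {linear H -> H} := idfun.
Let ops : seq {linear H -> H} := [:: I; T; S; Q].

Lemma ops_spanned x u a b c d : u = a *: x + b *: T x + c *: S x + d *: S (T x) ->
  spanned (evals ops x) u.
Proof.
move=> ->; exists (nth 0 [:: a; b; c; d]); rewrite !comb_cons comb_nil /=.
by rewrite addr0 !addrA.
Qed.

Lemma adjoint_pair_sym : adjoint_pair S T.
Proof. by move=> x y; rewrite innerC -TS -innerC. Qed.

Lemma indep_mod_I : indep_mod_finite_rank [:: I].
Proof.
apply: indep_mod_finite_rank_cons => // c fc; apply: id_infinite.
by apply: finite_rank_eq fc => x; rewrite comb_nil addr0.
Qed.

Let scaleS k x : S (k *: x) = k *: S x. Proof. exact: linearZ. Qed.

Let subS x y : S (x - y) = S x - S y. Proof. exact: linearB. Qed.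

(** For F = T - a with adjoint F', the finite-rank operators F, F', F' F lie in the span of I, T, S,
    S T, hence are locally dependent; diagonalizing F makes their relation global. *)
Lemma relation_scalar_plus_finite_rank a :
  finite_rank (fun x => T x - a *: x) -> op_relation.
Proof.
move=> fF.
pose F : {linear H -> H} := T \- a \*: idfun.
pose F' : {linear H -> H} := S \- a^* \*: idfun.
have FF' : adjoint_pair F F'.
  by move=> x y; rewrite /F /F' /= !innerE TS conjCK.
have F_eigen : eigen_adjoint F F'.
  move=> k x /eqP; rewrite /F /F' /= subr_eq -scalerDl => /eqP/TS_eigen ->.
  by rewrite rmorphD scalerDl addrK.
have fF' : finite_rank F' by apply: finite_rank_adjoint FF' fF.
have fFF : finite_rank (F' \o F) by case: fF' => s sP; exists s => x; apply: sP.
have depF x : ~ indep [:: F x; F' x; F' (F x)].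
  apply: (no_local_indep (Ws := ops) (As := [:: I])
    (Bs := [:: F; F'; (F' \o F : {linear H -> H})])) => //.
  - case=> [|[|[|[|//]]]] _ y /=.
    + by apply: (ops_spanned (a := 1) (b := 0) (c := 0) (d := 0)); inner_ring.
    + by apply: (ops_spanned (a := - a) (b := 1) (c := 0) (d := 0)); inner_ring.
    + by apply: (ops_spanned (a := - a^*) (b := 0) (c := 1) (d := 0)); inner_ring.
    + apply: (ops_spanned (a := a * a^* ) (b := - a^*) (c := - a) (d := 1)).
      by rewrite subS scaleS; inner_ring.
  - exact: indep_mod_I.
  - by case=> [|[|[|//]]].
have [c [i lt_i ci] c0] := finite_rank_local_relation FF' F_eigen fF depF.
(* The combination of F, F', F' F is expanded in I, T, S, S T. *)
exists (c 2%N * (a * a^*) - c 0%N * a - c 1%N * a^*), (c 0%N - c 2%N * a^*),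
  (c 1%N - c 2%N * a), (c 2%N); split.
  have [c2|] := eqVneq (c 2%N) 0; last by rewrite !orbT.
  rewrite c2 !mul0r !subr0 orbF.
  by case: i lt_i ci => [|[|[|//]]] _; rewrite ?c2 ?eqxx // => ->; rewrite ?orbT.
move=> x; rewrite -[RHS](c0 x) !comb_cons comb_nil /= subS scaleS.
by inner_ring.
Qed.

(** If I, T, S, S T were independent modulo finite rank, they would be independent at some vector.
    So some S T + b T + c S + g has finite rank; being locally dependent on its own, it vanishes. *)
Lemma relation_independent :
  (forall b c g, finite_rank (fun x => b *: T x + c *: S x + g *: x) ->
     b = 0 /\ c = 0) -> op_relation.
Proof.
move=> indTS.
have indS : indep_mod_finite_rank [:: S; I].
  apply: indep_mod_finite_rank_cons indep_mod_I => c fc.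
  have [|_ /eqP] := indTS 0 1 (c 0%N); last by rewrite oner_eq0.
  by apply: finite_rank_eq fc => x; rewrite comb_cons comb_nil; inner_ring.
have indT : indep_mod_finite_rank [:: T; S; I].
  apply: indep_mod_finite_rank_cons indS => c fc.
  have [|/eqP + _] := indTS 1 (c 0%N) (c 1%N); last by rewrite oner_eq0.
  by apply: finite_rank_eq fc => x; rewrite !comb_cons comb_nil; inner_ring.
have [[b [c [g fC]]]|nC] := pselect (exists b c g,
    finite_rank (fun x => Q x + b *: T x + c *: S x + g *: x)); last first.
  have indQ : indep_mod_finite_rank [:: Q; T; S; I].
    apply: indep_mod_finite_rank_cons indT => c fc; apply: nC.
    exists (c 0%N), (c 1%N), (c 2%N).
    by apply: finite_rank_eq fc => x; rewrite !comb_cons comb_nil; inner_ring.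
  (* With [Bs] empty, [no_local_indep] denies the independence of the empty family, which is
     absurd. *)
  suff: ~ indep (evals ([::] : seq {linear H -> H}) 0) by case.
  apply: (no_local_indep (Ws := ops) (As := [:: Q; T; S; I])) => //.
  case=> [|[|[|[|//]]]] _ y /=.
  + by apply: (ops_spanned (a := 0) (b := 0) (c := 0) (d := 1)); inner_ring.
  + by apply: (ops_spanned (a := 0) (b := 1) (c := 0) (d := 0)); inner_ring.
  + by apply: (ops_spanned (a := 0) (b := 0) (c := 1) (d := 0)); inner_ring.
  + by apply: (ops_spanned (a := 1) (b := 0) (c := 0) (d := 0)); inner_ring.
pose C : {linear H -> H} := Q \+ (b \*: T \+ (c \*: S \+ g \*: idfun)).
have {}fC : finite_rank C by apply: finite_rank_eq fC => x; inner_ring.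
exists g, b, c, 1; rewrite oner_eq0 !orbT; split=> // x.
have [C0|Cx] := eqVneq (C x) 0; first by rewrite -[RHS]C0; inner_ring.
suff: ~ indep (evals [:: C] x).
  by case; apply: indep_cons => // -[d]; rewrite comb_nil => /eqP; rewrite (negbTE Cx).
apply: (no_local_indep (Ws := ops) (As := [:: T; S; I])) => //; last by case.
case=> [|[|[|[|//]]]] _ y /=.
+ by apply: (ops_spanned (a := 0) (b := 1) (c := 0) (d := 0)); inner_ring.
+ by apply: (ops_spanned (a := 0) (b := 0) (c := 1) (d := 0)); inner_ring.
+ by apply: (ops_spanned (a := 1) (b := 0) (c := 0) (d := 0)); inner_ring.
+ by apply: (ops_spanned (a := g) (b := b) (c := c) (d := 1)); inner_ring.
Qed.

(** I and T are independent modulo finite rank. If S T is independent of them, [B] alone is locally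
    dependent, hence 0. Otherwise a finite-rank combination [C'] of S T, T, I and its adjoint add up
    to a symmetric [C], and the symmetric pair [C], [B] is locally dependent. *)
Lemma relation_symmetric w g :
  (forall a, ~ finite_rank (fun x => T x - a *: x)) -> w != 0 -> g^* = g ->
  finite_rank (fun x => w *: T x + w^* *: S x + g *: x) -> op_relation.
Proof.
move=> not_scalar w0 gg fB.
pose B : {linear H -> H} := w \*: T \+ (w^* \*: S \+ g \*: idfun).
have {}fB : finite_rank B by apply: finite_rank_eq fB => x; inner_ring.
have BB : adjoint_pair B B.
  by move=> x y; rewrite /B /= !innerE conjCK gg TS adjoint_pair_sym; ring.
have indT : indep_mod_finite_rank [:: T; I].
  apply: indep_mod_finite_rank_cons indep_mod_I => c fc.
  apply: (not_scalar (- c 0%N)).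
  by apply: finite_rank_eq fc => x; rewrite comb_cons comb_nil; inner_ring.
have [[b [c fC]]|nC] := pselect (exists b c,
    finite_rank (fun x => Q x + b *: T x + c *: x)); last first.
  have indQ : indep_mod_finite_rank [:: Q; T; I].
    apply: indep_mod_finite_rank_cons indT => c fc; apply: nC.
    exists (c 0%N), (c 1%N).
    by apply: finite_rank_eq fc => x; rewrite !comb_cons comb_nil; inner_ring.
  exists g, w, w^*, 0; rewrite w0 !orbT; split=> // x.
  have [B0|Bx] := eqVneq (B x) 0; first by rewrite -[RHS]B0; inner_ring.
  suff: ~ indep (evals [:: B] x).
    by case; apply: indep_cons => // -[d]; rewrite comb_nil => /eqP; rewrite (negbTE Bx).
  apply: (no_local_indep (Ws := ops) (As := [:: Q; T; I])) => //; last by case.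
  case=> [|[|[|[|//]]]] _ y /=.
  + by apply: (ops_spanned (a := 0) (b := 0) (c := 0) (d := 1)); inner_ring.
  + by apply: (ops_spanned (a := 0) (b := 1) (c := 0) (d := 0)); inner_ring.
  + by apply: (ops_spanned (a := 1) (b := 0) (c := 0) (d := 0)); inner_ring.
  + by apply: (ops_spanned (a := g) (b := w) (c := w^*) (d := 0)); inner_ring.
pose C' : {linear H -> H} := Q \+ (b \*: T \+ c \*: idfun).
pose D' : {linear H -> H} := Q \+ (b^* \*: S \+ c^* \*: idfun).
have CD' : adjoint_pair C' D'.
  by move=> x y; rewrite /C' /D' /= !innerE !conjCK TS adjoint_pair_sym TS.
have fC' : finite_rank C' by apply: finite_rank_eq fC => x; inner_ring.
have fD' : finite_rank D' by apply: finite_rank_adjoint CD' fC'.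
pose C : {linear H -> H} := C' \+ D'.
have fC2 : finite_rank C by apply: finite_rankD fC' fD'.
have CC : adjoint_pair C C.
  move=> x y; rewrite (innerDl (C' x) (D' x) y : inner (C x) y = _).
  rewrite (innerDr x (C' y) (D' y) : inner x (C y) = _) CD' addrC.
  by congr (_ + _); rewrite innerC -CD' -innerC.
have [|a1 [b1 [ab abE]]] := symmetric_locally_dependent CC BB.
  apply: (no_local_indep (Ws := ops) (As := [:: T; I]) (Bs := [:: C; B])) => //.
  case=> [|[|[|[|//]]]] _ y /=.
  + by apply: (ops_spanned (a := 0) (b := 1) (c := 0) (d := 0)); inner_ring.
  + by apply: (ops_spanned (a := 1) (b := 0) (c := 0) (d := 0)); inner_ring.
  + by apply: (ops_spanned (a := c + c^* ) (b := b) (c := b^* ) (d := 2)); inner_ring.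
  + by apply: (ops_spanned (a := g) (b := w) (c := w^*) (d := 0)); inner_ring.
  by case=> [|[|//]].
(* a1 C + b1 B is expanded in I, T, S, S T. Its last coefficient is nonzero unless a1 = 0, and then
   the coefficient of T is b1 w. *)
exists (a1 * (c + c^* ) + b1 * g), (a1 * b + b1 * w), (a1 * b^* + b1 * w^* ), (2 * a1).
split; last by move=> x; rewrite -[RHS](abE x); inner_ring.
rewrite mulf_eq0 pnatr_eq0 /=.
have [a10|] := eqVneq a1 0; last by rewrite !orbT.
rewrite a10 eqxx /= in ab.
by rewrite a10 !mul0r !add0r [b1 * w == 0]mulf_eq0 negb_or w0 ab !orbT.
Qed.

Theorem operator_relation : op_relation.
Proof.
have [[a fa]|not_scalar] := pselect (exists a, finite_rank (fun x => T x - a *: x)).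
  exact: relation_scalar_plus_finite_rank fa.
have [[a [b [g [nz fD]]]]|ind] := pselect (exists a b g, ((a != 0) || (b != 0)) /\
    finite_rank (fun x => a *: T x + b *: S x + g *: x)); last first.
  apply: relation_independent => b c g f.
  have [->|b0] := eqVneq b 0; last by case: ind; exists b, c, g; rewrite b0.
  have [->|c0] := eqVneq c 0; first by [].
  by case: ind; exists b, c, g; rewrite c0 orbT.
pose D : {linear H -> H} := a \*: T \+ (b \*: S \+ g \*: idfun).
pose D' : {linear H -> H} := b^* \*: T \+ (a^* \*: S \+ g^* \*: idfun).
have {}fD : finite_rank D by apply: finite_rank_eq fD => x; inner_ring.
have DD' : adjoint_pair D D'.
  by move=> x y; rewrite /D /D' /= !innerE !conjCK TS adjoint_pair_sym; ring.
have fD' : finite_rank D' by apply: finite_rank_adjoint DD' fD.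
have not_scalar' c : ~ finite_rank (fun x => T x - c *: x).
  by move=> fc; apply: not_scalar; exists c.
(* The phase turns the finite-rank [D] into e D + e^* D', which is symmetric with a nonzero
   coefficient at T. *)
have [e w0] := exists_phase nz.
apply: (relation_symmetric (g := e * g + (e * g)^* )) w0 _ _ => //.
  by rewrite rmorphD /= conjCK addrC.
apply: finite_rank_eq (finite_rankD (finite_rankZ e fD) (finite_rankZ e^* fD')) => x.
by rewrite !rmorphD !rmorphM /= !conjCK; inner_ring.
Qed.

End OperatorRelation.

(** * Riesz representation and adjoints *)

Section Riesz.
Variables (R : realType) (H : hilbertType R).
Implicit Types (x y z u v : H) (t : R[i]).

(** Squared norms, here and in [sqc], are taken in the ordered field [R], where real inequalities
    apply. *)
Definition sqn x : R := complex.Re (inner x x).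

Definition sqc t : R := complex.Re t ^+ 2 + complex.Im t ^+ 2.

Lemma sqcE t : (sqc t)%:C = `|t| ^+ 2.
Proof. exact: add_Re2_Im2. Qed.

Lemma sqn_norm x : (sqn x)%:C = `|x| ^+ 2.
Proof. by rewrite /sqn inner_norm RRe_real // realX // ger0_real. Qed.

Lemma inner_sqn x : inner x x = (sqn x)%:C.
Proof. by rewrite inner_norm sqn_norm. Qed.

Lemma sqn_ge0 x : 0 <= sqn x.
Proof. by rewrite -lecR sqn_norm exprn_ge0. Qed.

Lemma sqc_ge0 t : 0 <= sqc t.
Proof. by rewrite addr_ge0 // sqr_ge0. Qed.

Lemma sqc_eq0 t : sqc t = 0 -> t = 0.
Proof.
by move=> t0; apply/eqP; rewrite -normr_eq0 -sqrf_eq0 -sqcE t0.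
Qed.

Lemma sqn_eq0 x : sqn x = 0 -> x = 0.
Proof. by move=> x0; apply: inner_eq0; rewrite inner_sqn x0. Qed.

Lemma sqnDZ u t v :
  sqn (u + t *: v) = sqn u + sqc t * sqn v + 2 * complex.Re (t * inner v u).
Proof.
rewrite [LHS]/sqn !innerE (innerC u v) !inner_sqn /sqc.
by case: t => a b; case: (inner v u) => p q /=; ring.
Qed.

Lemma sqnD u v : sqn (u + v) = sqn u + sqn v + 2 * complex.Re (inner v u).
Proof.
by rewrite -[v in LHS]scale1r sqnDZ mul1r /sqc /= expr1n expr0n addr0 mul1r.
Qed.

Lemma sqnZ t u : sqn (t *: u) = sqc t * sqn u.
Proof.
by rewrite -[t *: u]add0r sqnDZ inner0r mulr0 mulr0 /sqn inner0r add0r addr0.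
Qed.

Lemma sqnN u : sqn (- u) = sqn u.
Proof. by rewrite /sqn !innerE opprK. Qed.

Lemma cauchy_schwarz u v : sqc (inner u v) <= sqn u * sqn v.
Proof.
have [v0|v0] := eqVneq (sqn v) 0.
  by rewrite v0 (sqn_eq0 v0) inner0r /sqc /= expr0n addr0 mulr0.
have v_gt0 : 0 < sqn v by rewrite lt_def v0 sqn_ge0.
have := sqn_ge0 (u + (- inner u v / (sqn v)%:C) *: v).
rewrite sqnDZ (innerC v u).
have vV : ((sqn v)%:C)^-1 = ((sqn v)^-1)%:C by rewrite fmorphV.
have -> : sqc (- inner u v / (sqn v)%:C) = sqc (inner u v) / sqn v ^+ 2.
  rewrite vV; case: (inner u v) => a b.
  by rewrite /sqc /=; field.
have -> : complex.Re (- inner u v / (sqn v)%:C * (inner u v)^* ) =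
    - (sqc (inner u v) / sqn v).
  rewrite vV; case: (inner u v) => a b.
  by rewrite /sqc /=; field.
move: (sqn u) (sqn v) (sqc _) v_gt0 {v0} => a b c b0.
have -> : a + c / b ^+ 2 * b + 2 * - (c / b) = (a * b - c) / b.
  by field; rewrite gt_eqF.
by rewrite pmulr_lge0 ?invr_gt0 // subr_ge0.
Qed.

Lemma normr_le_sqr (r s M : R[i]) : 0 <= r -> 0 <= s -> 0 <= M ->
  (r <= M * s) = (r ^+ 2 <= M ^+ 2 * s ^+ 2).
Proof. by move=> r0 s0 M0; rewrite -exprMn ler_sqr ?nnegrE ?mulr_ge0. Qed.

Lemma norm_le_sqn (M : R) x y : 0 <= M ->
  (`|x| <= M%:C * `|y|) = (sqn x <= M ^+ 2 * sqn y).
Proof.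
move=> M0; rewrite normr_le_sqr ?normr_ge0 ?lecR // -lecR.
by rewrite rmorphM rmorphXn /= !sqn_norm.
Qed.

Lemma sqcD_le s t : sqc (s + t) <= 2 * sqc s + 2 * sqc t.
Proof.
case: s t => a b [c d]; rewrite /sqc /=.
rewrite -subr_ge0.
have -> : 2 * (a ^+ 2 + b ^+ 2) + 2 * (c ^+ 2 + d ^+ 2) -
   ((a + c) ^+ 2 + (b + d) ^+ 2) = (a - c) ^+ 2 + (b - d) ^+ 2 by ring.
by rewrite addr_ge0 ?sqr_ge0.
Qed.

Lemma norm_lt_sqn (e : R) x : 0 < e -> (`|x| < e%:C) = (sqn x < e ^+ 2).
Proof.
move=> e0; rewrite -(ltr_pXn2r (ltn0Sn 1)) ?nnegrE ?normr_ge0 ?lecR ?ltW //.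
by rewrite -ltcR rmorphXn /= sqn_norm.
Qed.

Lemma sqn_complete (u : nat -> H) :
  (forall e : R, 0 < e -> exists N, forall m n, (N <= m)%N -> (N <= n)%N ->
     sqn (u m - u n) < e) ->
  exists l, forall e : R, 0 < e ->
    exists N, forall n, (N <= n)%N -> sqn (u n - l) < e.
Proof.
move=> u_cauchy; have u_cvg : cvg (u @ \oo).
  apply: cauchy_cvg; apply: cauchy_exP => eps eps0.
  have epsE : ((complex.Re eps)%:C) = eps by rewrite RRe_real // gtr0_real.
  have e0 : 0 < complex.Re eps by rewrite -ltcR epsE.
  have [N uN] := u_cauchy _ (exprn_gt0 2 e0).
  exists (u N), N => // n /= Nn; rewrite -ball_normE /= -epsE norm_lt_sqn //.
  exact: uN.
exists (lim (u @ \oo)) => e e0.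
have s0 : 0 < Num.sqrt e by rewrite sqrtr_gt0.
have /cvgrPdist_lt/(_ (Num.sqrt e)%:C) := u_cvg.
rewrite ltcR => /(_ s0)[N _ uN]; exists N => n Nn.
by have := uN n Nn; rewrite norm_lt_sqn // sqr_sqrtr ?ltW // -opprB sqnN.
Qed.

(* Minimizes J x = |N x|^2 - 2 Re (f x). For N = id this is the Riesz representation
   theorem; for general N it solves N^* N x = y. *)
Lemma coercive_representation (N : {linear H -> H}) (c K L : R)
    (f : {linear H -> R[i] | *%R}) :
  0 < c -> 0 <= K -> 0 <= L ->
  (forall x, c * sqn x <= sqn (N x)) -> (forall x, sqn (N x) <= L * sqn x) ->
  (forall x, sqc (f x) <= K * sqn x) ->
  exists x, forall z, inner (N z) (N x) = f z.
Proof.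
move=> c0 K0 L0 Nc NL fK.
pose J x := sqn (N x) - 2 * complex.Re (f x).
have ReD s t : complex.Re (s + t) = complex.Re s + complex.Re t by case: s; case: t.
(* With p = Re (f x), coercivity and p^2 <= (K + 1) |x|^2 give J x >= c p^2 / (K + 1) - 2 p, and
   completing the square bounds this below. K + 1 rather than K keeps the divisor positive. *)
have J_lb x : - ((K + 1) / c) <= J x.
  rewrite /J; have := le_trans (Nc x) (lexx _); have := fK x.
  have := sqn_ge0 x; case: (f x) => p q; rewrite /sqc /=.
  move: (sqn x) (sqn (N x)) => s n s0 fs cn.
  have K1 : 0 < K + 1 by rewrite ltr_wpDl.
  have p2 : p ^+ 2 <= (K + 1) * s by have := sqr_ge0 q; nra.
  have : c * p ^+ 2 / (K + 1) <= n.
    rewrite ler_pdivrMr //; nra.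
  have : 0 <= (c * p / (K + 1) - 1) ^+ 2 * ((K + 1) / c).
    by rewrite mulr_ge0 ?sqr_ge0 // divr_ge0 // ltW.
  have -> : (c * p / (K + 1) - 1) ^+ 2 * ((K + 1) / c) =
     c * p ^+ 2 / (K + 1) - 2 * p + (K + 1) / c.
    by field; rewrite !gt_eqF.
  lra.
have Jinf : has_inf (range J).
  split; first by exists (J 0), 0.
  by exists (- ((K + 1) / c)) => _ [x _ <-].
pose m := inf (range J).
have Jm x : m <= J x by apply: ge_inf; [exact: Jinf.2|exists x].
have /choice[u uJ] (n : nat) : exists x, J x < m + n.+1%:R^-1.
  have [|_ [x _ <-] Jx] := inf_adherent _ Jinf (eps := n.+1%:R^-1).
    by rewrite invr_gt0 ltr0n.
  by exists x.
have ND x y : N (x + y) = N x + N y by exact: linearD.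
have NN x : N (- x) = - N x by exact: linearN.
have NZ t x : N (t *: x) = t *: N x by exact: linearZ.
have fD x y : f (x + y) = f x + f y by exact: linearD.
have fZ t x : f (t *: x) = t * f x by exact: linearZ.
(* Parallelogram identity, in which the linear terms of [J] cancel; it makes minimizing sequences
   Cauchy. *)
have J_mid x y : sqn (N (x - y)) = 2 * J x + 2 * J y - 4 * J (2^-1 *: (x + y)).
  have h2 : (2^-1 : R[i]) = (2^-1 : R)%:C by rewrite fmorphV rmorph_nat.
  rewrite /J NZ fZ !ND NN fD sqnZ !sqnD sqnN h2 innerNl.
  rewrite /sqc; case: (f x) => p q; case: (f y) => p' q'.
  by case: (inner _ _) => v w /=; field.
have J_dir x z t : J (x + t *: z) =
    J x + sqc t * sqn (N z) + 2 * complex.Re (t * (inner (N z) (N x) - f z)).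
  rewrite /J ND NZ fD fZ sqnDZ.
  case: t (f x) (f z) (inner _ _) => a b [p q] [p' q'] [v w].
  by rewrite /sqc /=; ring.
have J_grad x z (e : R) : J x <= m + e ->
    sqc (inner (N z) (N x) - f z) <= e * (sqn (N z) + 1).
  move=> Jx; set d := _ - f z.
  (* The step along [z] is chosen to decrease [J]; adding 1 to |N z|^2 avoids a zero divisor. *)
  have := Jm (x + (- ((sqn (N z) + 1)^-1)%:C * d^* ) *: z).
  rewrite J_dir -/d; have := sqn_ge0 (N z); have := sqc_ge0 d.
  move: (sqn (N z)) (J x) Jx => Z j jm D0 Z0.
  have Z1 : 0 < Z + 1 by rewrite ltr_wpDl.
  have -> : sqc (- ((Z + 1)^-1)%:C * d^* ) = sqc d / (Z + 1) ^+ 2.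
    case: (d) => p q; rewrite /sqc /=; field; exact: lt0r_neq0.
  have -> : complex.Re (- ((Z + 1)^-1)%:C * d^* * d) = - (sqc d / (Z + 1)).
    case: (d) => p q; rewrite /sqc /=; field; exact: lt0r_neq0.
  move: (sqc d) D0 => D D0 mj.
  rewrite -ler_pdivrMr //.
  have : 0 <= D / (Z + 1) ^+ 2 by rewrite divr_ge0 // exprn_ge0 // ltW.
  have : D / (Z + 1) = D / (Z + 1) ^+ 2 * Z + D / (Z + 1) ^+ 2.
    by field; exact: lt0r_neq0.
  nra.
have [l lP] : exists l, forall e : R, 0 < e ->
    exists N, forall n, (N <= n)%N -> sqn (u n - l) < e.
  apply: sqn_complete => e e0.
  (* By [J_mid], c |u_i - u_j|^2 < 2 / (i + 1) + 2 / (j + 1), hence the threshold e c / 4. *)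
  have [k _ kP] := near_infty_natSinv_lt (PosNum (mulr_gt0 (divr_gt0 e0 (ltr0n R 4)) c0)).
  exists k => i j /= ki kj; rewrite -(ltr_pM2l c0).
  apply: le_lt_trans (Nc _) _; rewrite J_mid.
  have := Jm (2^-1 *: (u i + u j)); have := kP _ ki; have := kP _ kj.
  have := uJ i; have := uJ j; rewrite /=.
  move: (J (u i)) (J (u j)) (J _) (i.+1%:R^-1) (j.+1%:R^-1) => *; nra.
exists l => z; apply/eqP; rewrite -subr_eq0; apply/eqP/sqc_eq0/eqP.
rewrite eq_le sqc_ge0 andbT; apply/ler_addgt0Pr => e e0; rewrite add0r.
pose Z := sqn (N z).
have Z0 : 0 <= Z by exact: sqn_ge0.
(* [A] collects the constants of the final estimate: the squared error is at most A e' once |u_n -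
   l|^2 and 1 / (n + 1) are below e' = e / A. *)
pose A := 2 * L * Z + 2 * (Z + 1).
have A0 : 0 < A by rewrite ltr_wpDl ?mulr_ge0 // mulr_gt0 // ltr_wpDl.
have [k1 k1P] := lP (e / A) (divr_gt0 e0 A0).
have [k2 _ k2P] := near_infty_natSinv_lt (PosNum (divr_gt0 e0 A0)).
pose n := maxn k1 k2.
have ul := k1P n (leq_maxl _ _).
have ne := k2P n (leq_maxr _ _).
have grad := J_grad (u n) z _ (ltW (uJ n)).
have -> : inner (N z) (N l) - f z =
    - inner (N z) (N (u n - l)) + (inner (N z) (N (u n)) - f z).
  by rewrite ND NN innerDr innerNr; ring.
apply: le_trans (sqcD_le _ _) _.
have sqcN t : sqc (- t) = sqc t by case: t => p q; rewrite /sqc /= !sqrrN.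
have := cauchy_schwarz (N z) (N (u n - l)); have := NL (u n - l).
rewrite sqcN -/Z.
have /= {}ne := ne.
have eE : e = A * (e / A) by field; exact: lt0r_neq0.
have := sqc_ge0 (inner (N z) (N (u n - l))); have := sqn_ge0 (N (u n - l)).
have s0 := sqn_ge0 (u n - l).
move: (e / A) eE ul ne => e' -> ul ne w0 q0 wL qw.
have h1 : Z * sqn (N (u n - l)) <= Z * (L * e').
  apply: ler_wpM2l => //; apply: le_trans wL _; exact/ler_wpM2l/ltW.
have h2 : (n.+1%:R^-1) * (Z + 1) <= e' * (Z + 1).
  by apply: ler_wpM2r; [rewrite addr_ge0|exact: ltW].
have -> : A * e' = 2 * (Z * (L * e')) + 2 * (e' * (Z + 1)) by rewrite /A; ring.
by rewrite lerD // ler_pM2l //; apply: le_trans h1 || apply: le_trans h2.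
Qed.

End Riesz.

(** * Adjoints, projections and ranks of bounded operators *)

Section BoundedOperators.
Variables (R : realType) (H : hilbertType R).
Implicit Types (x y z u v : H) (s : seq H) (T S P : 'B(H)).

Lemma exists_linear (U : lmodType R[i]) (V : zmodType) (m : GRing.Scale.law R[i] V)
    (f : U -> V) : linear_for m f -> exists g : {linear U -> V | m}, g =1 f.
Proof.
move=> lf; pose fL := GRing.isLinear.Build R[i] U V m f lf.
pose g : {linear U -> V | m} := HB.pack f fL.
by exists g.
Qed.

Lemma operator_sqn_bound T :
  exists2 K : R, 0 <= K & forall x, sqn (T x) <= K * sqn x.
Proof.
have [M MP] := operator_bounded T; exists (`|M| ^+ 2); first exact: exprn_ge0.
move=> x; rewrite -norm_le_sqn //; apply: le_trans (MP x) _.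
by rewrite ler_wpM2r // lecR ler_norm.
Qed.

Lemma exists_bounded_operator (f : H -> H) (K : R) : linear f -> 0 <= K ->
  (forall x, sqn (f x) <= K * sqn x) -> exists T, T =1 f.
Proof.
move=> lf K0 fK; have [g gf] := exists_linear lf.
have gb : exists M : R, forall x, `|g x| <= M%:C * `|x|.
  exists (Num.sqrt K) => x; rewrite norm_le_sqn ?sqrtr_ge0 //.
  by rewrite sqr_sqrtr // gf.
by exists (BoundedOperator gb).
Qed.

(** S y is the Riesz representative of z |-> <T z, y>, obtained from [coercive_representation] for
    the identity. *)
Lemma adjoint_exists T : exists S, is_adjoint T S.
Proof.
have [K K0 TK] := operator_sqn_bound T.
have /choice[S SP] y : exists w, forall x, inner x w = inner (T x) y.
  have [|f fE] := @exists_linear H R[i] *%R (fun x => inner (T x) y).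
    by move=> a u v; rewrite linearP innerDl innerZl.
  have [||||x|x|w wE] := @coercive_representation R H idfun 1 (K * sqn y) 1 f.
  - exact: ltr01.
  - by rewrite mulr_ge0 ?sqn_ge0.
  - exact: ler01.
  - by move=> x; rewrite mul1r.
  - by rewrite mul1r.
  - rewrite fE; apply: le_trans (cauchy_schwarz _ _) _.
    by rewrite mulrAC ler_wpM2r ?sqn_ge0.
  by exists w => x; rewrite wE fE.
have lS : linear S.
  move=> a u v; apply: inner_injr => x; rewrite SP innerDr innerZr.
  by rewrite innerDr innerZr !SP.
have [|S' S'E] := exists_bounded_operator lS K0; last first.
  by exists S' => x y; rewrite S'E SP.
(* |S y|^4 = |<T (S y), y>|^2 <= K |S y|^2 |y|^2, so [S] inherits the bound [K] of [T]. *)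
move=> y; have := cauchy_schwarz (T (S y)) y; rewrite -SP inner_sqn.
have := TK (S y); have := sqn_ge0 (S y); have := sqn_ge0 y.
rewrite /sqc /= expr0n addr0; move: (sqn y) (sqn (S y)) (sqn (T (S y))) => a b c.
move=> a0 b0 cb bca; have : b * b <= b * (K * a).
  by rewrite -expr2 (le_trans bca) // mulrA [b * K]mulrC ler_wpM2r.
have [-> _|b0'] := eqVneq b 0; first by rewrite mulr_ge0.
by rewrite ler_pM2l // lt_def b0' b0.
Qed.

(** The coefficients [c] are chosen vector by vector; linearity comes from [pE], which characterizes
    p x by orthogonality even when [s] is dependent. *)
Lemma exists_projection s : exists P, projection P /\
  forall x, spanned s (P x) /\ (spanned s x -> P x = x).
Proof.
have /choice[c cP] := orthogonal_projection s.
pose p x := comb (c x) s.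
have orth u : spanned s u -> orthogonal_to s u -> u = 0.
  by move=> [d ->] du; apply: inner_eq0; rewrite inner_combr big1 // => i _;
    rewrite du ?mulr0.
have pE x u : spanned s u -> orthogonal_to s (x - u) -> p x = u.
  move=> su xu; apply/eqP; rewrite -subr_eq0; apply/eqP/orth.
    apply: spannedD; first by exists (c x).
    by rewrite -scaleN1r; apply: spannedZ.
  move=> i lt_is; have -> : p x - u = (x - u) - (x - p x) by inner_ring.
  by rewrite innerDl innerNl xu // cP // oppr0 addr0.
have lp : linear p.
  move=> a x y; apply: pE.
    by apply: spannedD; [apply: spannedZ|]; [exists (c x)|exists (c y)].
  move=> i lt_is; have -> : a *: x + y - (a *: p x + p y) = a *: (x - p x) + (y - p y).
    by inner_ring.
  by rewrite innerDl innerZl !cP // mulr0 addr0.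
have pp x y : inner (x - p x) (p y) = 0.
  by rewrite inner_combr big1 // => i _; rewrite cP ?mulr0.
have [|P PE] := exists_bounded_operator lp (ler01 : 0 <= 1 :> R).
  move=> x; rewrite mul1r -[x in leRHS](subrK (p x)) sqnD.
  by rewrite innerC pp conjC0 /= mulr0 addr0 lerDr sqn_ge0.
have pid x : spanned s x -> p x = x.
  by move=> sx; apply: pE => // i _; rewrite subrr inner0l.
have sp x : spanned s (p x) by exists (c x).
exists P; split; last by move=> x; rewrite PE; split=> // /pid.
split=> [x|x y] /=; rewrite !PE; first exact: pid (sp x).
have := pp x y; rewrite innerDl innerNl => /eqP; rewrite subr_eq0 => /eqP ->.
have : inner (p x) (y - p y) = 0 by rewrite innerC pp conjC0.
by rewrite innerDr innerNr => /eqP; rewrite subr_eq0 => /eqP.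
Qed.

Lemma indep_lin_indep s : indep s <-> lin_indep (fun i : 'I_(size s) => s`_i).
Proof.
split=> [inds c c0 i|inds c c0 i lt_is].
  pose d (j : nat) := if insub j is Some k then c (k : 'I_(size s)) else 0.
  have dE (j : 'I_(size s)) : d j = c j by rewrite /d valK.
  rewrite -dE; apply: inds => //.
  by rewrite /comb; under eq_bigr => j _ do rewrite dE.
exact: (inds (fun j => c j) c0 (Ordinal lt_is)).
Qed.

Lemma lin_indep_seq n (v : 'I_n -> H) : lin_indep v ->
  exists s, [/\ indep s, size s = n & forall i, (i < n)%N -> exists j, s`_i = v j].
Proof.
move=> indv; exists [seq v i | i <- enum 'I_n]; split.
- move=> c; rewrite /comb size_map size_enum_ord => c0 i lt_in.
  apply: (indv (fun j => c j) _ (Ordinal lt_in)); rewrite -[RHS]c0.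
  by apply: eq_bigr => j _; rewrite (nth_map j) ?size_enum_ord // nth_ord_enum.
- by rewrite size_map size_enum_ord.
- move=> i lt_in; exists (Ordinal lt_in).
  rewrite (nth_map (Ordinal lt_in)) ?size_enum_ord //; congr v.
  by apply: val_inj; rewrite /= nth_enum_ord.
Qed.

Lemma infinite_not_finite_rank : infinite_dimensional H -> ~ finite_rank (@idfun H).
Proof.
move=> inf [s sP]; suff : (lin_dim [set: H] <= (size s)%:R%:E)%E.
  by rewrite inf leye_eq.
apply: ub_ereal_sup => _ [n [v indv _] <-]; rewrite lee_fin ler_nat.
have [t [indt nt _]] := lin_indep_seq indv.
by rewrite -nt; apply: steinitz indt _ => i _; apply: sP.
Qed.

(** Equal ranks, finite or infinite, are exploited by transferring finite independent families: if
    [rank Y] is at least n + 1, some independent family in the range of [Y] has more than n members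
    and can be cut down. *)
Lemma rank_transfer (X Y : H -> H) s : rank X = rank Y -> indep s ->
  (forall i, (i < size s)%N -> range X s`_i) ->
  exists t, [/\ indep t, size t = size s & forall i, (i < size s)%N -> range Y t`_i].
Proof.
move=> XY inds sX.
have : ((size s)%:R%:E <= rank Y)%E.
  rewrite -XY; apply: ereal_sup_ubound; exists (size s) => //.
  by exists (fun i : 'I_(size s) => s`_i); [apply/indep_lin_indep|move=> i; apply: sX].
case: (size s) => [|n] nY; first by exists [::].
have [[m [v [indv vY]] lt_nm]|nex] := pselect (exists2 m, exists v : 'I_m -> H,
    lin_indep v /\ (forall i, range Y (v i)) & (n < m)%N).
  have indv' : lin_indep (fun i : 'I_n.+1 => v (widen_ord lt_nm i)).
    move=> c c0 i; pose d (j : 'I_m) := if insub (val j) is Some k then c k else 0.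
    have dE (j : 'I_n.+1) : d (widen_ord lt_nm j) = c j by rewrite /d /= valK.
    rewrite -dE; apply: indv; rewrite -[RHS]c0.
    rewrite (bigID (fun j : 'I_m => (j < n.+1)%N)) /= [X in _ + X]big1 ?addr0.
      by rewrite (big_ord_narrow lt_nm); apply: eq_bigr => j _; rewrite dE.
    by move=> j; rewrite /d => nj; rewrite insubN // scale0r.
  have [t [indt st tv]] := lin_indep_seq indv'.
  by exists t; split=> // i /tv[j ->].
suff /(le_trans nY) : (rank Y <= n%:R%:E)%E by rewrite lee_fin ler_nat ltnn.
apply: ub_ereal_sup => _ [m [v indv vY] <-]; rewrite lee_fin ler_nat leqNgt.
by apply/negP => lt_nm; apply: nex; exists m => //; exists v.
Qed.

Lemma rank_zero (X Y : H -> H) : rank X = rank Y -> X =1 \0 -> Y =1 \0.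
Proof.
move=> XY X0 x; apply: contrapT => /eqP Yx.
have ind1 : indep [:: Y x].
  by apply: indep_cons => // -[c]; rewrite comb_nil => /eqP; rewrite (negbTE Yx).
have [|t [indt st tX]] := rank_transfer (esym XY) ind1.
  by case=> // _; exists x.
have [y _ Xy] := tX 0%N isT; move: Xy; rewrite X0 => /esym t0.
have := @steinitz _ _ [::] t indt; rewrite st => /(_ _)/notF; apply.
by case=> // _; rewrite t0; apply: spanned0.
Qed.

Lemma perp_adjoint P x y : projection P -> inner (perp P x) y = inner x (perp P y).
Proof. by move=> [_ PP]; rewrite /perp /= !innerE PP. Qed.

(** * Consequences of the common rank property *)

Variables (T S : 'B(H)).
Hypotheses (TS : is_adjoint T S) (T_CR : common_rank T).

Lemma common_rank_reductive : orthogonally_reductive T.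
Proof. by move=> P pP; apply: rank_zero; apply: T_CR. Qed.

Lemma eigen_conj (X Y : H -> H) k l x : adjoint_pair X Y -> x != 0 ->
  X x = k *: x -> Y x = l *: x -> l = k^*.
Proof.
move=> XY x0 Xx Yx; have := XY x x; rewrite Xx Yx innerZl innerZr.
move=> /mulIf ->; first by rewrite conjCK.
by apply: contra_neq x0 => /inner_eq0.
Qed.

Lemma line_projection x : exists P, [/\ projection P,
  forall y, exists l, P y = l *: x, forall l, perp P (l *: x) = 0 &
  forall y, perp P y = 0 -> exists l, y = l *: x].
Proof.
have [P [pP PE]] := exists_projection [:: x].
have Pline y : exists l, P y = l *: x.
  by have [[c ->] _] := PE y; exists (c 0%N); rewrite comb_cons comb_nil addr0.
exists P; split=> // [l|y].
  rewrite /perp /= (PE _).2 ?subrr //.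
  exact/spannedZ/(@spanned_nth _ _ [:: x] 0%N).
by rewrite /perp /= => /eqP; rewrite subr_eq0 => /eqP ->.
Qed.

(** Let P project onto the line of an eigenvector x of T. Then P^perp T P = 0, so P T P^perp = 0 by
    equality of ranks, and its adjoint P^perp S P vanishes: S x lies on the line. For an eigenvector
    of S, the argument runs backwards. *)
Lemma common_rank_eigen : eigen_adjoint T S /\ eigen_adjoint S T.
Proof.
have perpTS P y z : projection P ->
    inner ((P \o T \o perp P) y) z = inner y ((perp P \o S \o P) z).
  by move=> pP /=; rewrite pP.2 TS perp_adjoint.
have Px P x : perp P x = 0 -> P x = x.
  by rewrite /perp /= => /eqP; rewrite subr_eq0 => /eqP <-.
split=> k x kx; have [->|x0] := eqVneq x 0; rewrite ?linear0 ?scaler0 //;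
  have [P [pP Pline Pm Pker]] := line_projection x;
  have {}Px : P x = x by (apply: Px; have := Pm 1; rewrite scale1r).
- have TP : perp P \o T \o P =1 \0.
    by move=> y /=; have [l ->] := Pline y; rewrite linearZ /= kx scalerA Pm.
  have PT : P \o T \o perp P =1 \0 by apply: rank_zero TP; rewrite T_CR.
  have [|l Sx] := Pker (S x).
    apply: inner_injr => y; have := perpTS P y x pP.
    by rewrite PT inner0l inner0r /= Px => <-.
  by rewrite Sx (eigen_conj TS x0 kx Sx).
- have PT : P \o T \o perp P =1 \0.
    move=> y; apply: inner_injl => z; rewrite perpTS // inner0l /=.
    by have [l ->] := Pline z; rewrite linearZ /= kx scalerA Pm inner0r.
  have TP : perp P \o T \o P =1 \0 by apply: rank_zero PT; rewrite T_CR.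
  have [|l Tx] := Pker (T x).
    by have := TP x; rewrite /= Px.
  by rewrite Tx (eigen_conj TS x0 Tx kx) conjCK.
Qed.

(* Let P project onto M = span (x, T x) and p, q be the images of S x, S (T x) under
   I - P. As T x lies in M, P^perp T P has rank at most 1. The products of
   P T P^perp p, P T P^perp q with x, T x form the Gram matrix of (p, q), so
   independence of x, T x, S x, S (T x) would give P T P^perp rank 2. *)
Lemma common_rank_local x : ~ indep [:: x; T x; S x; S (T x)].
Proof.
move=> ind4; pose s := [:: x; T x].
have [P [pP PE]] := exists_projection s.
have Ps y : spanned s y -> perp P y = 0.
  by move=> sy; rewrite /perp /= (PE y).2 // subrr.
have s0 : spanned s x by exact: (@spanned_nth _ _ s 0%N).
have s1 : spanned s (T x) by exact: (@spanned_nth _ _ s 1%N).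
have perp_lin : linear (perp P) by move=> a u v; rewrite /perp /= linearP; inner_ring.
have [Q QE] := exists_linear perp_lin.
pose t := [:: perp P (S x); perp P (S (T x))].
have indt : indep t.
  move=> c; rewrite !comb_cons comb_nil addr0 /= => c0.
  have [d dE] : spanned s (c 0%N *: S x + c 1%N *: S (T x)).
    set z := _ + _; have : perp P z = 0.
      rewrite -QE /z linearD !linearZ /= !QE.
      exact: c0.
    rewrite /perp /= => /eqP; rewrite subr_eq0 => /eqP ->.
    exact: (PE _).1.
  have := ind4 (nth 0 [:: - d 0%N; - d 1%N; c 0%N; c 1%N]).
  rewrite !comb_cons comb_nil addr0 /= dE !comb_cons comb_nil => ind.
  have {}ind := ind _; case=> [|[|//]] _.
    by apply: (ind _ 2%N) => //; inner_ring.
  by apply: (ind _ 3%N) => //; inner_ring.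
pose X := P \o T \o perp P.
have indX : indep [:: X (t`_0); X (t`_1)].
  apply: (gram_indep (u := nth 0 s)).
  have /indep_gram := indt; congr (is_true (\det _ != 0)).
  apply/matrixP => i j; rewrite !mxE.
  have XE y z : spanned s z -> inner (X y) z = inner y (perp P (S z)).
    by move=> sz; rewrite /X /= pP.2 (PE z).2 // TS perp_adjoint.
  by case: i j => [[|[|//]] ?] [[|[|//]] ?]; rewrite /= XE.
have [|r [indr sr rY]] := rank_transfer (T_CR pP) indX.
  by case=> [|[|//]] _; [exists t`_0|exists t`_1].
have := @steinitz _ _ [:: perp P (T (T x))] r indr; rewrite sr => /(_ _)/notF; apply.
move=> i /rY[y _ <-] /=; have [[d ->] _] := PE y.
rewrite !comb_cons comb_nil addr0 (linearD T) !linearZ /=.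
rewrite -[perp P (_ + _)]QE linearD !linearZ /= !QE (Ps (T x)) // scaler0 add0r.
exact/spannedZ/(@spanned_nth _ _ [:: _] 0%N).
Qed.

End BoundedOperators.

(** * Operators of the form a A + b *)

Section AffineForms.
Variables (R : realType) (H : hilbertType R).
Implicit Types (x y z u v : H) (a b c k w : R[i]) (T S A B P : 'B(H)).

Lemma sqnD_le u v : sqn (u + v) <= 2 * sqn u + 2 * sqn v.
Proof.
have := sqn_ge0 (u - v); rewrite !sqnD sqnN innerNl.
by case: (inner v u) => p q /=; lra.
Qed.

Lemma affine_operator T a b : exists A, A =1 a \*: T \+ b \*: idfun.
Proof.
have [K K0 TK] := operator_sqn_bound T.
apply: (@exists_bounded_operator _ _ _ (2 * (sqc a * K) + 2 * sqc b)).
- by move=> k u v; rewrite /= linearP; inner_ring.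
- by rewrite addr_ge0 ?mulr_ge0 ?sqc_ge0.
move=> x; apply: le_trans (sqnD_le _ _) _; rewrite /= !sqnZ.
have := ler_wpM2l (sqc_ge0 a) (TK x); lra.
Qed.

Lemma adjoint_affine A B T S a b : is_adjoint A B -> is_adjoint T S ->
  T =1 a \*: A \+ b \*: idfun -> S =1 a^* \*: B \+ b^* \*: idfun.
Proof.
move=> AB TS TE x; apply: inner_injr => y; rewrite -TS TE /= !innerE AB.
by rewrite !conjCK.
Qed.

Lemma normal_affine A B T a b : is_adjoint A B -> A \o B =1 B \o A ->
  T =1 a \*: A \+ b \*: idfun -> normal_operator T.
Proof.
move=> AB comm TE; have [S TS] := adjoint_exists T; exists S => // x.
have SE := adjoint_affine AB TS TE; have /= ABx := comm x.
rewrite /= !SE /= !TE /= !linearD !linearZ /= ABx.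
by inner_ring.
Qed.

(** Given y, [coercive_representation] solves <T z, T x> = <z, y>, that is S (T x) = y, and
    normality turns this into T (S x) = y. The lower bound makes [T] injective and its inverse
    bounded. *)
Lemma normal_bounded_below_invertible T S (c : R) :
  is_adjoint T S -> T \o S =1 S \o T -> 0 < c ->
  (forall x, c * sqn x <= sqn (T x)) ->
  exists U : 'B(H), U \o T =1 idfun /\ T \o U =1 idfun.
Proof.
move=> TS comm c0 Tc; have [K K0 TK] := operator_sqn_bound T.
have Tinj x y : T x = T y -> x = y.
  move=> Txy; apply/eqP; rewrite -subr_eq0; apply/eqP/sqn_eq0/eqP.
  rewrite eq_le sqn_ge0 andbT -(pmulr_rle0 _ c0) (le_trans (Tc _)) //.
  by rewrite linearB Txy subrr /sqn inner0l.
have /choice[U UP] y : exists x, T x = y.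
  have [|f fE] := @exists_linear R H R[i] *%R (fun z => inner z y).
    by move=> a u v; rewrite innerDl innerZl.
  have [|x xP] := @coercive_representation R H T c (sqn y) K f c0 (sqn_ge0 y) K0 Tc TK.
    by move=> x; rewrite fE mulrC cauchy_schwarz.
  exists (S x); rewrite -[LHS]/((T \o S) x) comm; apply: inner_injr => z.
  by rewrite /= -TS xP fE.
have lU : linear U by move=> a u v; apply: Tinj; rewrite linearP !UP.
have ci : 0 <= c^-1 by rewrite invr_ge0 ltW.
have [|V VE] := exists_bounded_operator lU ci.
  by move=> y; rewrite -ler_pdivrMl ?invr_gt0 // invrK -{2}(UP y).
by exists V; split=> x /=; rewrite VE ?UP //; apply: Tinj; rewrite UP.
Qed.

Lemma spectrum_affine A B T a b (z : R[i]) (c : R) : is_adjoint A B -> A \o B =1 B \o A ->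
  T =1 a \*: A \+ b \*: idfun -> 0 < c ->
  (forall x, c * sqn x <= sqn (a *: A x + (b - z) *: x)) -> ~ spectrum T z.
Proof.
move=> AB comm TE c0 Nc; apply; have [N NE] := affine_operator A a (b - z).
have [M NM] := adjoint_exists N.
have NMc : N \o M =1 M \o N.
  have ME := adjoint_affine AB NM NE.
  move=> x; have /= ABx := comm x.
  rewrite /= !ME /= !NE /= !linearD !linearZ /= ABx.
  by inner_ring.
have [|U [UN NU]] := normal_bounded_below_invertible NM NMc c0.
  by move=> x; rewrite NE; apply: Nc.
have TN : T \- z \*: idfun =1 N by move=> x; rewrite NE /= TE; inner_ring.
exists U; split=> x; first by rewrite -[RHS]UN /= -TN.
by rewrite -[RHS]NU; apply: TN.
Qed.

(** For z off the line b + R a, put w = (z - b) / a. As <x, A x> is real, |(A - w) x|^2 = |(A - Re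
    w) x|^2 + (Im w)^2 |x|^2. *)
Lemma selfadjoint_affine_spectrum A T a b : selfadjoint A ->
  T =1 a \*: A \+ b \*: idfun -> circlinear (spectrum T).
Proof.
(* If a = 0, only b can be in the spectrum, and 1 provides the nonzero direction of a line. *)
move=> AA TE; right; exists b, (if a == 0 then 1 else a); split.
  by have [_|//] := eqVneq a 0; exact: oner_neq0.
move=> z; apply: contraPP => nz.
have [a0|a0] := eqVneq a 0.
  have bz : b - z != 0.
    apply: contra_notN nz; rewrite subr_eq0 a0 eqxx => /eqP <-.
    by exists 0; rewrite // mul0r addr0.
  have c0 : 0 < sqc (b - z).
    by rewrite lt_def sqc_ge0 andbT; apply: contra_neq bz => /sqc_eq0.
  apply: (spectrum_affine AA _ TE c0) => // x.
  by rewrite a0 scale0r add0r sqnZ.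
rewrite (negbTE a0) in nz.
pose w := (z - b) / a.
have wE : z = b + w * a by rewrite /w divfK // addrC subrK.
have w0 : complex.Im w != 0.
  apply: contra_notN nz => /eqP w0; exists (complex.Re w) => //.
  by rewrite wE; congr (_ + _ * _); case: (w) w0 => p q /= ->.
have sa : 0 < sqc a.
  by rewrite lt_def sqc_ge0 andbT; apply: contra_neq a0 => /sqc_eq0.
have c0 : 0 < sqc a * complex.Im w ^+ 2 by rewrite mulr_gt0 // exprn_even_gt0.
apply: (spectrum_affine AA _ TE c0) => // x.
have -> : a *: A x + (b - z) *: x = a *: (A x + (- w) *: x).
  by rewrite wE; inner_ring.
rewrite sqnZ -mulrA ler_pM2l // sqnDZ.
have := sqn_ge0 (A x + (- (complex.Re w)%:C) *: x); rewrite sqnDZ.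
have : inner x (A x) = (inner x (A x))^* by rewrite -innerC AA.
case: (inner x (A x)) => r s; case: (w) => p q [s0].
have -> : s = 0 by lra.
by rewrite /sqc /=; nra.
Qed.

(** The circle has centre b and radius |a|: A being isometric, the norm of a A x + (b - z) x is at
    least the distance between |a| and |b - z|, times |x|. *)
Lemma unitary_affine_spectrum A T a b : a != 0 -> unitary_operator A ->
  T =1 a \*: A \+ b \*: idfun -> circlinear (spectrum T).
Proof.
move=> a0 [B AB [BA AB1]] TE; left.
have sa : 0 < sqc a.
  by rewrite lt_def sqc_ge0 andbT; apply: contra_neq a0 => /sqc_eq0.
exists b, (Num.sqrt (sqc a)); split; first by rewrite sqrtr_gt0.
move=> z; apply: contraPP => nz.
pose p := Num.sqrt (sqc a); pose q := Num.sqrt (sqc (b - z)).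
have pq : p - q != 0.
  apply: contra_notN nz => /eqP/eqP; rewrite subr_eq0 /circle /= => /eqP pq.
  rewrite -/p pq; apply/eqP; rewrite -(eqrXn2 (n := 2)) ?normr_ge0 ?lecR ?sqrtr_ge0 //.
  rewrite -sqcE -rmorphXn /= sqr_sqrtr ?sqc_ge0 //; apply/eqP; congr (_%:C).
  by case: (z) (b) => ? ? [? ?]; rewrite /sqc /=; ring.
have comm : A \o B =1 B \o A by move=> x; rewrite AB1 BA.
have c0 : 0 < (p - q) ^+ 2 by rewrite exprn_even_gt0.
apply: (spectrum_affine AB comm TE c0) => x.
have Ax : sqn (A x) = sqn x by rewrite /sqn AB -[B (A x)]/((B \o A) x) BA.
rewrite sqnD !sqnZ Ax.
have := cauchy_schwarz ((b - z) *: x) (a *: A x); rewrite !sqnZ Ax.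
have -> : sqc a = p ^+ 2 by rewrite sqr_sqrtr ?sqc_ge0.
have -> : sqc (b - z) = q ^+ 2 by rewrite sqr_sqrtr ?sqc_ge0.
have p0 : 0 <= p by apply: sqrtr_ge0.
have q0 : 0 <= q by apply: sqrtr_ge0.
have := sqn_ge0 x; move: (sqn x) (inner _ _) => s [r r'] s0.
rewrite /sqc /= => rr; suff : - (p * q * s) <= r by nra.
have : `|r| <= p * q * s.
  rewrite -ler_sqr ?nnegrE ?mulr_ge0 // real_normK ?num_real //.
  apply: le_trans (_ : r ^+ 2 + r' ^+ 2 <= _); first by rewrite lerDl sqr_ge0.
  by apply: le_trans rr _; rewrite le_eqVlt; apply/orP; left; apply/eqP; ring.
by rewrite ler_norml => /andP[].
Qed.

End AffineForms.

(** * The affine form of operators with property (CR) *)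

Section CommonRankForm.
Variables (R : realType) (H : hilbertType R).
Implicit Types (x y z u v : H) (a b c d g k w : R[i]) (T S A B P : 'B(H)).

Lemma orthogonally_reductive_affine A T a b : a != 0 ->
  T =1 a \*: A \+ b \*: idfun -> orthogonally_reductive T -> orthogonally_reductive A.
Proof.
move=> a0 TE redT P pP PAP x.
have P2 y : P (P y) = P y := pP.1 y.
have PTP : P \o T \o perp P =1 \0.
  move=> y; have /= PA0 := PAP y.
  rewrite /= TE /= linearD !linearZ /= PA0.
  by rewrite /perp /= linearB /= P2 subrr !scaler0 addr0.
have /= := redT P pP PTP x; rewrite TE /perp /=.
rewrite !linearD !linearZ /= P2 => PT0; apply/eqP.

have : a *: (A (P x) - P (A (P x))) = 0 by rewrite -[RHS]PT0; inner_ring.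
by move/eqP; rewrite scaler_eq0 (negbTE a0).
Qed.

(** The relation says that w T + g / 2 is the opposite of its adjoint; [A] is i times this
    operator. *)
Lemma selfadjoint_form T S w g : is_adjoint T S -> w != 0 -> g^* = g ->
  (forall x, w *: T x + w^* *: S x + g *: x = 0) ->
  exists a b A, selfadjoint A /\ T =1 a \*: A \+ b \*: idfun.
Proof.
move=> TS w0 gg rel.
have [A AE] := affine_operator T ('i * w) ('i * g / 2).
have i0 : 'i != 0 :> R[i] by rewrite neq0Ci.
exists ('i * w)^-1, (- (g / (2 * w))), A; split=> [x y|x]; last first.
  rewrite /= AE /=; apply: inner_injl => z; rewrite !innerE; field.
  by rewrite w0 i0.
have := congr1 (fun u => inner x u) (rel y); rewrite !innerE conjCK gg => E.
rewrite !AE /= !innerE TS !rmorphM fmorphV /= conjCi rmorph_nat gg.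
apply/eqP; rewrite -subr_eq0; apply/eqP; rewrite -[RHS](mulr0 'i) -E.
by field.
Qed.

(** Taking adjoints conjugates the coefficients, exchanges T and S, and fixes S T. *)
Lemma adjoint_relation T S a b c d : is_adjoint T S ->
  (forall x, a *: x + b *: T x + c *: S x + d *: S (T x) = 0) ->
  forall x, a^* *: x + c^* *: T x + b^* *: S x + d^* *: S (T x) = 0.
Proof.
move=> TS rel y; apply: inner_injr => x; rewrite inner0r -(inner0l y) -(rel x).
have ST u v : inner (S u) v = inner u (T v) by rewrite innerC -TS -innerC.
by rewrite !innerE !conjCK !ST !TS; ring.
Qed.

(* Completing the square, |T x + b^* x|^2 = rho |x|^2, so T + b^* is a multiple of an
   isometry A. If A^* u = 0, then u is an eigenvector of T^*, hence of T, and
   A u = 0; thus A is onto. *)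
Lemma isometric_form T S b g : is_adjoint T S -> eigen_adjoint S T ->
  orthogonally_reductive T -> g^* = g ->
  (forall x, S (T x) + b *: T x + b^* *: S x + g *: x = 0) ->
  (exists k w A, selfadjoint A /\ T =1 k \*: A \+ w \*: idfun) \/
  (exists k w A, [/\ k != 0, orthogonally_reductive A, unitary_operator A &
     T =1 k \*: A \+ w \*: idfun]).
Proof.
move=> TS ST redT gg rel; pose rho := b * b^* - g.
have STE x : S (T x) = - (b *: T x + b^* *: S x + g *: x).
  by apply/eqP; rewrite -addr_eq0 !addrA rel.
pose V x := T x + b^* *: x.
have VE x : inner (V x) (V x) = rho * inner x x.
  have -> : inner (V x) (V x) = 
      inner x (S (T x) + b *: T x + b^* *: S x + (b * b^* ) *: x).
    by rewrite /V !innerE !conjCK !TS rmorphM /= conjCK; ring.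
  by rewrite STE !innerE !conjCK rmorphM /= conjCK gg /rho; ring.
have rhoE : rho = (complex.Re rho)%:C.
  rewrite RRe_real // CrealE /rho rmorphB rmorphM /= conjCK gg.
  by rewrite mulrC.
have VE' x : sqn (V x) = complex.Re rho * sqn x.
  by rewrite /sqn VE [in LHS]rhoE inner_sqn /= mul0r subr0.
(* If rho is not positive, then V = 0 and T is the scalar -b^*, so the zero operator serves as
   [A]. *)
have [r0|r0] := ltP 0 (complex.Re rho); last first.
  left; have [A AE] := affine_operator T 0 0.
  have A0 x : A x = 0 by rewrite AE /= !scale0r addr0.
  exists 0, (- b^* ), A; split=> [x y|x]; first by rewrite !A0 inner0l inner0r.
  rewrite /= A0 scaler0 add0r scaleNr; apply/eqP; rewrite -addr_eq0.
  apply/eqP/sqn_eq0/eqP; rewrite eq_le sqn_ge0 andbT -/(V x) VE'.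
  by rewrite mulr_le0_ge0 ?sqn_ge0.
right; pose q := Num.sqrt (complex.Re rho).
have q0 : q%:C != 0 by rewrite fmorph_eq0 gt_eqF ?sqrtr_gt0.
have qq : q%:C * q%:C = rho by rewrite -rmorphM -expr2 sqr_sqrtr ?ltW -?rhoE.
have qc : (q%:C)^* = q%:C by apply/CrealP; rewrite complex_real.
pose k := (q%:C)^-1; have kc : k^* = k by rewrite fmorphV /= qc.
have [A AE] := affine_operator T k (k * b^* ).
have TE : T =1 q%:C \*: A \+ (- b^* ) \*: idfun.
  by move=> x; rewrite /= AE /= /k; apply: inner_injl => z; rewrite !innerE; field.
exists q%:C, (- b^* ), A; split=> //.
  exact: orthogonally_reductive_affine TE redT.
have [B AB] := adjoint_exists A; have BE := adjoint_affine TS AB AE.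
have BA x : B (A x) = x.
  rewrite BE AE /= rmorphM /= kc conjCK linearD !linearZ /= STE.
  apply: inner_injl => z; rewrite !innerE.
  have -> : g = b * b^* - q%:C * q%:C by rewrite qq /rho; ring.
  by rewrite /k; field.
exists B => //; split=> // x /=; apply/eqP; rewrite -subr_eq0; apply/eqP.
set u := _ - x; have Bu : B u = 0 by rewrite /u linearB BA subrr.
have Su : S u = (- b) *: u.
  apply/eqP; rewrite -subr_eq0 scaleNr opprK; apply/eqP.
  rewrite -[RHS](scaler0 _ q%:C) -Bu BE /= kc rmorphM /= kc conjCK.
  by apply: inner_injl => z; rewrite !innerE /k; field.
have Tu := ST _ _ Su.
have Au : A u = 0 by rewrite AE /= Tu rmorphN; inner_ring.
by rewrite -(BA u) Au linear0.
Qed.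

(** The relation is combined with its adjoint into a symmetric one, to which [selfadjoint_form]
    applies if d = 0 and [isometric_form] otherwise. *)
Lemma common_rank_form T : infinite_dimensional H -> common_rank T ->
  (exists k w A, selfadjoint A /\ T =1 k \*: A \+ w \*: idfun) \/
  (exists k w A, [/\ k != 0, orthogonally_reductive A, unitary_operator A &
     T =1 k \*: A \+ w \*: idfun]).
Proof.
move=> /infinite_not_finite_rank inf T_CR; have [S TS] := adjoint_exists T.
have [eTS eST] := common_rank_eigen TS T_CR.
have [a [b [c [d [nz rel]]]]] :=
  operator_relation TS eTS inf (common_rank_local TS T_CR).
have rel' := adjoint_relation TS rel.
have [d0|d0] := eqVneq d 0.
  (* b = c = d = 0 would leave a I = 0 with a nonzero, contrary to infinite dimension. *)
  have nz' : (b != 0) || (c != 0).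
    move: nz; rewrite d0 eqxx orbF; case: eqVneq => //= a0; rewrite ?a0 // => _.
    apply: contrapT => /negP; rewrite negb_or !negbK => /andP[/eqP b0 /eqP c0].
    apply: inf; exists [::] => x; exists (fun=> 0); rewrite comb0 /=.
    have := rel x; rewrite b0 c0 d0 !scale0r !addr0 => /eqP.
    by rewrite scaler_eq0 (negbTE a0) => /eqP.
  have [e w0] := exists_phase nz'.
  left; apply: (selfadjoint_form (g := e * a + (e * a)^* )) TS w0 _ _.
    by rewrite rmorphD /= conjCK addrC.
  move=> x; have := rel' x; have := rel x; rewrite d0 conjC0 !scale0r !addr0.
  move=> E E'; transitivity (e *: (a *: x + b *: T x + c *: S x) +
      e^* *: (a^* *: x + c^* *: T x + b^* *: S x)).
    by rewrite !rmorphD !rmorphM /= !conjCK; inner_ring.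
  by rewrite E E' !scaler0 addr0.
have relE x : S (T x) = - (d^-1 *: (a *: x + b *: T x + c *: S x)).
  apply: (scalerI d0); rewrite scalerN scalerA mulfV // scale1r; apply/eqP.
  by rewrite -addr_eq0 addrC rel.
have dc : d^* != 0 by rewrite conjC_eq0.
have relE' x : S (T x) = - ((d^* )^-1 *: (a^* *: x + c^* *: T x + b^* *: S x)).
  apply: (scalerI dc); rewrite scalerN scalerA mulfV // scale1r; apply/eqP.
  by rewrite -addr_eq0 addrC rel'.
(* These are the coefficients of the mean of the relation divided by d and its adjoint divided by
   d^*. *)
apply: (isometric_form (b := (b / d + (c / d)^* ) / 2)
  (g := (a / d + (a / d)^* ) / 2)) TS eST _ _ _.
- exact: common_rank_reductive.
- by rewrite !(rmorphM, rmorphD, fmorphV) /= !conjCK conjC1 addrC.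
move=> x; rewrite (_ : S (T x) = 2^-1 *: S (T x) + 2^-1 *: S (T x)); last first.
  by apply: inner_injl => z; rewrite !innerE; field.
rewrite [X in 2^-1 *: X + _]relE [X in _ + 2^-1 *: X]relE'.
rewrite !(rmorphM, rmorphD, fmorphV) /= !conjCK conjC1.
by apply: inner_injl => z; rewrite !innerE; field; rewrite d0 dc.
Qed.

End CommonRankForm.

Theorem theorem5p8 (R : realType) (H : hilbertType R)
    (H_infinite_dim : infinite_dimensional H)
    (H_separable : separable H)
    (T : 'B(H)) (T_CR : common_rank T) :
  (exists (lambda mu : R[i]) (A : 'B(H)),
      (selfadjoint A \/ (orthogonally_reductive A /\ unitary_operator A)) /\
      T =1 lambda \*: A \+ mu \*: idfun) /\
  (normal_operator T /\ circlinear (spectrum T)).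
Proof.
have [[k [w [A [AA TE]]]]|[k [w [A [k0 redA uA TE]]]]] :=
  common_rank_form H_infinite_dim T_CR.
  split; first by exists k, w, A; split=> //; left.
  by split; [exact: normal_affine AA _ TE|exact: selfadjoint_affine_spectrum AA TE].
split; first by exists k, w, A; split=> //; right.
split; last exact: unitary_affine_spectrum k0 uA TE.
have [B AB [BA AB1]] := uA.
by apply: normal_affine AB _ TE => x; rewrite AB1 BA.
Qed.
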